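(* Let $\mathcal G=(M,w^-,w^+)$ be a conditioned weighted graph with $M$ of size $N\times N$, let $\lambda$ be the eigenvalue of $M$ of maximal modulus, and let $(\ell,r)$ be a pair of non-negative left and right $\lambda$-eigenvectors of $M$ with $\ell\cdot r=1$. Then: (1) The sequence $(\mu_k)$ of weighted distributions converges weakly, as $k\to\infty$, toward a probability measure $\mu$ on $\Omega$, which is concentrated on the set $\Xi\subseteq\Omega$ of infinite paths. (2) For each integer $k\geq0$, let $X_k:\Xi\to\{1,\dots,N\}$ denote the $k$-th natural projection. Under $\mu$, $(X_k)_{k\geq0}$ is a Markov chain, whose initial distribution $h$ and transition matrix $P=(P_{i,j})$ ($P_{i,j}$ being the probability to jump from $i$ to $j$) are given by $$h(i)=\frac{w^-(i)\,r(i)}{w^-\cdot r},\qquad P_{i,j}=\lambda^{-1}M_{i,j}\frac{r(j)}{r(i)}\quad\text{if }r(i)\neq0,$$ independently of the choice of $r$; if $r(i)=0$, the row $P_{i,\bullet}$ is an arbitrary probability vector. The chain can only reach states $i$ such that $r(i)\neq0$. (3) Restricted to the set of reachable states, the chain has a unique stationary measure $\pi$, given by $\pi(i)=\ell(i)r(i)$ for all $i\in\{1,\dots,N\}$. (4) In Case A, the chain is ergodic. In Case B, the chain has a unique ergodic component, namely the $N-K$ last indices $\{K+1,\dots,N\}$, and hence the states in $\{1,\dots,K\}$ are all transient.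
   Context: A conditioned weighted graph is a triple $\mathcal G=(M,w^-,w^+)$ where $M$ is a non-negative real $N\times N$ matrix, $N>1$, and $w^-,w^+:\{1,\dots,N\}\to[0,\infty)$ (identified with a row vector and a column vector respectively), such that: (i) $M$ has a unique eigenvalue $\lambda$ of maximal modulus, and it is simple (then $\lambda$ is real and positive, and there exist non-zero non-negative left (row) and right (column) $\lambda$-eigenvectors $\ell$, $r$, which can be normalized by $\ell\cdot r=1$; such a normalized pair is unique up to replacing it by $(t\ell,t^{-1}r)$, $t>0$); (ii) $w^-\cdot r>0$ and $\ell\cdot w^+>0$. Case A: $M$ is primitive (some power of $M$ has only positive entries) and $w^-,w^+$ are not identically zero. Case B: for some integer $0<K<N$, $M=\begin{pmatrix}A&T\\0&\widetilde M\end{pmatrix}$ with $A$ of size $K\times K$, $A,T,\widetilde M$ non-negative, $\widetilde M$ primitive, spectral radii satisfying $\rho(A)<\rho(\widetilde M)$, and $w^-$, $w^+$ not identically zero on the $N-K$ last indices. (In both cases $(M,w^-,w^+)$ is a conditioned weighted graph.) A path of length $k\geq0$ is a sequence $(x_0,\dots,x_k)$ of indices with $M_{x_i,x_{i+1}}>0$ for $0\leq i<k$; its weight is $w(x)=w^-(x_0)M_{x_0,x_1}\cdots M_{x_{k-1},x_k}w^+(x_k)$. Infinite paths are defined likewise. $G_k$ is the set of paths of length $k$, and the weighted distribution $\mu_k$ on $G_k$ is $\mu_k(z)=w(z)/Z_k$, $Z_k=\sum_{z\in G_k}w(z)$, which is well defined ($Z_k>0$) for all $k$ large enough. $\Omega$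 is the compact space of all finite or infinite paths, with its canonical topology (finite paths being viewed as infinite sequences by padding with an extra cemetery symbol, and the topology being induced by the product topology); for a finite path $x$, the set of all finite or infinite paths that start with $x$ is open and closed. Each $\mu_k$ is regarded as a probability measure on $\Omega$ via $G_k\subset\Omega$.
   Formalization: In Case B, uniqueness of the ergodic component is among sets of reachable states, and transience under P is claimed for states i ≤ K with r(i) ≠ 0 (an arbitrary row may be absorbing); every i ≤ K is shown to be visited only finitely often almost surely. *)

(* Defs.v *)
From HB Require Import structures.
From mathcomp Require Import all_boot all_order all_algebra.
From mathcomp Require Import complex.
From mathcomp Require Import all_classical all_reals all_analysis.

Set Implicit Arguments.
Unset Strict Implicit.
Unset Printing Implicit Defensive.

Import Order.TTheory GRing.Theory Num.Theory.
Import numFieldNormedType.Exports.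

Local Open Scope classical_set_scope.
Local Open Scope ring_scope.

(* The eigenvalues of a real matrix are taken in [R[i]]. *)
Definition complexify (R : realType) m n (A : 'M[R]_(m, n)) : 'M[R[i]]_(m, n) :=
  map_mx (real_complex R) A.

(* [lam] is the only eigenvalue of maximal modulus, and it is simple (as a
   root of the characteristic polynomial). *)
Definition dominant_eigenvalue (R : realType) n (A : 'M[R]_n) (lam : R[i]) :=
  [/\ eigenvalue (complexify A) lam,
      forall z : R[i], eigenvalue (complexify A) z -> z != lam ->
        `|z| < `|lam|
    & mup lam (char_poly (complexify A)) = 1%N].

Definition spectral_radius (R : realType) n (A : 'M[R]_n) : R :=
  sup [set complex.Re `|z| | z in [set z : R[i] | eigenvalue (complexify A) z]].

Definition primitive (R : realType) n (A : 'M[R]_n) :=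
  exists2 m : nat, (0 < m)%N & forall i j, 0 < (A ^+ m) i j.

Definition eigenpair (R : realType) n (A : 'M[R]_n) (lam : R)
    (l : 'rV[R]_n) (r : 'cV[R]_n) :=
  [/\ (forall i, 0 <= l 0 i) /\ (forall i, 0 <= r i 0),
      l *m A = lam *: l, A *m r = lam *: r & (l *m r) 0 0 = 1].

Record cwg (R : realType) (N : nat) := CWG {
  cwM : 'M[R]_N;
  cwI : 'rV[R]_N;
  cwF : 'cV[R]_N;
  cw_gt1 : (1 < N)%N;
  cwM_ge0 : forall i j, 0 <= cwM i j;
  cwI_ge0 : forall i, 0 <= cwI 0 i;
  cwF_ge0 : forall i, 0 <= cwF i 0;
  cw_dominant : exists lam : R[i], dominant_eigenvalue cwM lam;
  (* The dominant eigenvalue is automatically real, and the pair [(l, r)] is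
     unique up to replacing it by [(t l, r / t)] with [t > 0]. *)
  cw_pos : forall (lam : R) (l : 'rV[R]_N) (r : 'cV[R]_N),
    dominant_eigenvalue cwM lam%:C%C -> eigenpair cwM lam l r ->
    0 < (cwI *m r) 0 0 /\ 0 < (l *m cwF) 0 0 }.

Definition case_A (R : realType) N (G : cwg R N) :=
  [/\ primitive (cwM G), cwI G != 0 & cwF G != 0].

Definition case_B (R : realType) N (G : cwg R N) (K : nat) :=
  exists (L : nat) (eN : N = (K + L)%N)
    (A : 'M[R]_K) (T : 'M[R]_(K, L)) (M' : 'M[R]_L),
  [/\ (0 < K < N)%N,
      castmx (eN, eN) (cwM G) = block_mx A T 0 M',
      primitive M',
      spectral_radius A < spectral_radius M'
    & (exists2 i : 'I_N, (K <= i)%N & cwI G 0 i != 0) /\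
      (exists2 i : 'I_N, (K <= i)%N & cwF G i 0 != 0)].

Section Paths.
Context (R : realType) (N : nat) (G : cwg R N).

Definition is_path k (z : k.+1.-tuple 'I_N) : bool :=
  [forall m : 'I_k, 0 < cwM G (tnth z (inord m)) (tnth z (inord m.+1))].

Definition kpath k := {z : k.+1.-tuple 'I_N | is_path z}.

Definition weight k (z : k.+1.-tuple 'I_N) : R :=
  cwI G 0 (tnth z ord0)
  * (\prod_(m < k) cwM G (tnth z (inord m)) (tnth z (inord m.+1)))
  * cwF G (tnth z ord_max) 0.

Definition partition_fun k : R := \sum_(z : kpath k) weight (val z).

(* [None] is the cemetery symbol. *)
Definition padded_seq := {ptws nat -> discrete_topology (option 'I_N)}.

(* There is no empty path: [x 0] is a state. *)
Definition padded_path : set padded_seq :=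
  [set x | (x 0%N <> None) /\
    forall m, match x m, x m.+1 return Prop with
              | Some i, Some j => 0 < cwM G i j
              | None, Some _ => False
              | _, None => True
              end].

Definition Omega := set_type padded_path.

HB.instance Definition _ := Topological.copy Omega
  (initial_topology (set_val : padded_path -> padded_seq)).

Lemma pad_subproof k (z : kpath k) :
  (onth (val z) : padded_seq) \in padded_path.
Proof.
apply/mem_set; split => [|m].
  by case: z => -[[|a s] sz].
have onthz j : (j < k.+1)%N -> onth (val z) j = Some (tnth (val z) (inord j)).
  move=> jk; rewrite onthE (tnth_nth (tnth (val z) ord0)) inordK//.
  by rewrite (nth_map (tnth (val z) ord0)) ?size_tuple.
have [mk|km] := ltnP m k.
  rewrite !onthz ?(ltnW mk)//; last by rewrite ltnS ltnW.
  by have /forallP/(_ (Ordinal mk)) := valP z.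
rewrite (@onth_default _ m.+1) ?size_tuple//.
by case: (onth (val z) m).
Qed.

Definition pad k (z : kpath k) : Omega :=
  exist _ (onth (val z) : padded_seq) (pad_subproof z).

Definition default_state : 'I_N := Ordinal (ltnW (cw_gt1 G)).

Lemma path0_subproof : is_path [tuple default_state].
Proof. by apply/forallP => -[]. Qed.

HB.instance Definition _ :=
  isPointed.Build Omega (pad (exist _ [tuple default_state] path0_subproof)).

Definition infinite_paths : set Omega := [set x | forall m, val x m <> None].

(* Only meaningful on [infinite_paths]; elsewhere [default_state] is returned
   after the death of the path. *)
Definition nth_state (m : nat) (x : Omega) : 'I_N := odflt default_state (val x m).

End Paths.

Arguments partition_fun {R N} G k.
Arguments infinite_paths {R N} G _.
Arguments nth_state {R N} G m x.

Definition borelType (T : ptopologicalType) :=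
  g_sigma_algebraType (@open T).

Definition weakly_cvg (R : realType) (T : ptopologicalType)
    (mus : nat -> {measure set (borelType T) -> \bar R})
    (mu : {measure set (borelType T) -> \bar R}) : Prop :=
  forall f : T -> R, continuous f -> bounded_fun f ->
    (\int[mus k]_x (f x)%:E @[k --> \oo] --> \int[mu]_x (f x)%:E)%E.

Section WeightedDistribution.
Context (R : realType) (N : nat) (G : cwg R N) (k : nat).

(* When [partition_fun G k = 0] this is the null measure. *)
Definition wdist (A : set (borelType (Omega G))) : \bar R :=
  (\sum_(z : kpath G k)
     (weight G (val z) / partition_fun G k)%:E * \d_(pad z : borelType (Omega G)) A)%E.

Lemma weight_ge0 (z : k.+1.-tuple 'I_N) : 0 <= weight G z.
Proof.
rewrite /weight mulr_ge0 ?cwF_ge0// mulr_ge0 ?cwI_ge0//.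
by apply: prodr_ge0 => m _; exact: cwM_ge0.
Qed.

Lemma wdist_coef_ge0 (z : k.+1.-tuple 'I_N) :
  0 <= weight G z / partition_fun G k.
Proof.
by rewrite divr_ge0 ?weight_ge0// sumr_ge0// => y _; exact: weight_ge0.
Qed.

Let wdist0 : wdist set0 = 0%E.
Proof. by rewrite /wdist big1// => z _; rewrite measure0 mule0. Qed.

Let wdist_ge0 A : (0 <= wdist A)%E.
Proof.
apply: sume_ge0 => z _; apply: mule_ge0; last exact: measure_ge0.
by rewrite lee_fin wdist_coef_ge0.
Qed.

Let wdist_sigma_additive : semi_sigma_additive wdist.
Proof.
move=> F mF tF mUF; rewrite [X in _ --> X](_ : _ =
    lim ((fun n => \sum_(0 <= i < n) wdist (F i)) @ \oo))%E.
  by apply: is_cvg_ereal_nneg_natsum => n _; exact: wdist_ge0.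
rewrite nneseries_sum; last first.
  move=> z n _; apply: mule_ge0; last exact: measure_ge0.
  by rewrite lee_fin wdist_coef_ge0.
apply: eq_bigr => z _.
exact: (@measure_semi_bigcup _ _ _
  (mscale (NngNum (wdist_coef_ge0 (val z))) \d_(pad z : borelType (Omega G)))).
Qed.

HB.instance Definition _ := isMeasure.Build _ _ _ wdist
  wdist0 wdist_ge0 wdist_sigma_additive.

Lemma wdist_setT : 0 < partition_fun G k -> wdist setT = 1%E.
Proof.
move=> Z0; rewrite /wdist.
under eq_bigr do rewrite diracT mule1.
by rewrite sumEFin -mulr_suml divff ?gt_eqF.
Qed.

End WeightedDistribution.

Arguments wdist {R N} G k A.

Section MarkovChain.
Context (R : realType) (N : nat).

Definition prob_vector (p : 'rV[R]_N) :=
  (forall i, 0 <= p 0 i) /\ \sum_i p 0 i = 1.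

Definition stochastic (P : 'M[R]_N) := forall i, prob_vector (row i P).

Section Process.
Context d (T : measurableType d) (mu : probability T R) (X : nat -> T -> 'I_N).

Definition cond_prob (A B : set T) : \bar R := (mu (A `&` B) / mu B)%E.

Definition markov_chain (h : 'rV[R]_N) (P : 'M[R]_N) :=
  [/\ prob_vector h /\ stochastic P,
      forall m i, measurable (X m @^-1` [set i]),
      forall i, mu (X 0%N @^-1` [set i]) = (h 0 i)%:E
    & forall m (s : nat -> 'I_N) (j : 'I_N),
        let past := [set x | forall n, (n <= m)%N -> X n x = s n] in
        mu past <> 0%E ->
        cond_prob (X m.+1 @^-1` [set j]) past = (P (s m) j)%:E].

Definition reachable : set 'I_N :=
  [set i | exists m, mu (X m @^-1` [set i]) <> 0%E].

End Process.

Definition visited_infinitely_often (T : Type) (X : nat -> T -> 'I_N)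
    (i : 'I_N) : set T :=
  lim_sup_set (fun m => X m @^-1` [set i]).

Implicit Types (P : 'M[R]_N) (C : set 'I_N).

(* Probability vectors on [C], extended by [0] outside [C], that are invariant
   under the restriction of [P] to [C]. *)
Definition stationary_on C P (p : 'rV[R]_N) :=
  [/\ prob_vector p, forall i, ~ C i -> p 0 i = 0
    & forall j, C j -> \sum_(i | i \in C) p 0 i * P i j = p 0 j].

Definition communicating C P :=
  forall i j, C i -> C j -> exists m : nat, 0 < (P ^+ m) i j.

(* The gcd of the possible return times is 1. *)
Definition aperiodic P (i : 'I_N) :=
  forall d : nat, (forall m : nat, (0 < m)%N -> 0 < (P ^+ m) i i -> (d %| m)%N) ->
    d = 1%N.

Definition ergodic_on C P := communicating C P /\ forall i, C i -> aperiodic P i.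

Definition ergodic_component P C :=
  [/\ C !=set0, forall i j, C i -> 0 < P i j -> C j & communicating C P].

(* Probability, starting from [j], that [i] is visited at time [m.+1] and at no
   earlier positive time. *)
Fixpoint first_visit P (i : 'I_N) (m : nat) (j : 'I_N) : R :=
  if m is m'.+1 then \sum_(k | k != i) P j k * first_visit P i m' k else P j i.

Definition transient P (i : 'I_N) :=
  (\sum_(0 <= m <oo) (first_visit P i m i)%:E < 1)%E.

End MarkovChain.

Definition initial_dist (R : realType) N (G : cwg R N) (r : 'cV[R]_N) :
    'rV[R]_N :=
  \row_i (cwI G 0 i * r i 0 / (cwI G *m r) 0 0).

(* The rows indexed by zeros of [r] are arbitrary probability vectors. *)
Definition transition_mx (R : realType) N (G : cwg R N) (lam : R)
    (r : 'cV[R]_N) (P : 'M[R]_N) :=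
  forall i, (r i 0 != 0 ->
               forall j, P i j = lam^-1 * cwM G i j * (r j 0 / r i 0)) /\
            (r i 0 = 0 -> prob_vector (row i P)).

(* Main.v *)
Require Import Defs.
From HB Require Import structures.
From mathcomp Require Import all_boot all_order all_algebra.
From mathcomp Require Import complex.
From mathcomp Require Import all_classical all_reals all_analysis.
From mathcomp Require Import measurable_realfun ring lra.

Set Implicit Arguments.
Unset Strict Implicit.
Unset Printing Implicit Defensive.

Import Order.TTheory GRing.Theory Num.Theory.
Import numFieldNormedType.Exports.

Local Open Scope classical_set_scope.
Local Open Scope ring_scope.

(** The theorem rests on one spectral fact: if [lam] is a simple eigenvalue of
    [M] that dominates all others, then [M ^+ k / lam ^+ k] tends to the rank one
    matrix [r *m l], at a geometric rate ([dominant_powers_decay]).  To see this,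
    deflate: [B := M / lam - r *m l] satisfies [M ^+ k / lam ^+ k = B ^+ k + r *m l]
    for [0 < k], and every eigenvalue of [B] has modulus [< 1].  Indeed a left
    eigenvector of [B] for a nonzero eigenvalue is orthogonal to [r], hence an
    eigenvector of [M]; it cannot belong to [lam], because two orthogonal left and
    right eigenvectors force a multiple root of the characteristic polynomial
    ([orthogonal_eigenvectors_multiple_root]).  That the powers of a matrix with
    spectral radius [< 1] decay follows from the Cayley-Hamilton theorem, by
    removing the linear factors one at a time ([geometric_decay_powers]).

    A path of length [k] starting with [x_0, ..., x_m] has total weight
    [w^-(x_0) M_{x_0,x_1} ... (M ^+ (k - m) w^+)(x_m)], so the spectral fact gives
    the limit of the probability of each cylinder ([wdist_cylinder_cvg]).  These
    limits are consistent, because [M *m r = lam *: r], and a consistent family of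
    cylinder probabilities comes from a measure: subdivide [0, 1[ into nested
    intervals whose lengths are the given probabilities and push Lebesgue measure
    forward along the address map ([path_measure_exists]).  As path space is
    compact, continuous functions are uniformly close to functions of finitely
    many coordinates, and so convergence on cylinders is weak convergence
    ([weakly_cvg_cylinders]).

    The limit is a Markov chain whose transition matrix is the Doob transform of
    [M] by [r]: [P ^+ m] is conjugate to [M ^+ m / lam ^+ m] on the states where
    [r] does not vanish ([doob_exp]), so [P ^+ m i j] tends to [l j * r j] for
    each of these states [i].  This limit gives at once the uniqueness of the stationary measure and
    the irreducibility and aperiodicity of the set where [l * r] is positive.  In
    the primitive case this set contains all states.  In the block triangular case
    it is the last block, since [l] vanishes on the first one ([case_B_structure]); the
    last block is closed and reached from the first, which makes the first states
    transient ([transient_to_closed]), and the probability to be in a state of the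
    first block at time [m] decays geometrically, so that Borel-Cantelli applies. *)

(** * Geometrically decaying sequences *)

Definition geometric_decay (R : realType) (u : nat -> R) :=
  exists2 s : R, 0 < s < 1 & exists2 C, 0 <= C & forall k, `|u k| <= C * s ^+ k.

(** Any rate strictly between [max z s] and [1] works, [s] being a rate for [e]; the
    midpoint is taken. The case [z = 0] says that shifting the index is harmless. *)
Lemma geometric_decay_recurrence (R : realType) (u e : nat -> R) (z : R) :
  0 <= z < 1 -> (forall k, `|u k.+1| <= z * `|u k| + `|e k|) ->
  geometric_decay e -> geometric_decay u.
Proof.
move=> /andP[z0 z1] ue [s /andP[s0 s1] [C C0 eC]].
pose m := Num.max z s; pose t := (1 + m) / 2.
have m1 : m < 1 by rewrite gt_max z1.
have m0 : 0 < m by rewrite lt_max s0 orbT.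
have zm : z <= m by rewrite le_max lexx.
have sm : s <= m by rewrite le_max lexx orbT.
have tm : m < t by rewrite /t; lra.
have t1 : t < 1 by rewrite /t; lra.
have tz : 0 < t - z by lra.
exists t; first by rewrite t1 (lt_trans m0 tm).
pose D := `|u 0%N| + C / (t - z).
have D0 : 0 <= D by rewrite /D addr_ge0// divr_ge0// ltW.
exists D => //.
have CD : C <= D * (t - z).
  by rewrite /D mulrDl divfK ?gt_eqF// lerDr mulr_ge0// ltW.
have t0 : 0 < t by lra.
elim=> [|k IH]; first by rewrite mulr1 /D lerDl divr_ge0// ltW.
apply: le_trans (ue k) _.
have h1 : z * `|u k| <= z * (D * t ^+ k) by rewrite ler_wpM2l.
have h2 : `|e k| <= D * (t - z) * t ^+ k.
  apply: le_trans (eC k) _; apply: ler_pM => //; first by rewrite exprn_ge0// ltW.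
  by rewrite lerXn2r// ?nnegrE ?ltW//; lra.
apply: le_trans (lerD h1 h2) _.
rewrite exprS; lra.
Qed.

Lemma geometric_decay_cvg0 (R : realType) (u : nat -> R) :
  geometric_decay u -> u k @[k --> \oo] --> (0 : R).
Proof.
move=> [s /andP[s0 s1] [C C0 uC]].
have h : C * s ^+ k @[k --> \oo] --> (0 : R).
  rewrite -(mulr0 C); apply: cvgM; first exact: cvg_cst.
  by apply: cvg_expr; rewrite ger0_norm// ltW.
apply/norm_cvg0P; apply: squeeze_cvgr (cvg_cst 0) h; near=> k.
by rewrite normr_ge0 uC.
Unshelve. all: by end_near. Qed.

Lemma geometric_decay_add (R : realType) (u v : nat -> R) :
  geometric_decay u -> geometric_decay v ->
  geometric_decay (fun k => u k + v k).
Proof.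
move=> [s /andP[s0 s1] [C C0 uC]] [t /andP[t0 t1] [D D0 vD]].
exists (Num.max s t); first by rewrite lt_max s0 gt_max s1.
exists (C + D); first by rewrite addr_ge0.
move=> k; apply: le_trans (ler_normD _ _) _; rewrite mulrDl lerD//.
  apply: le_trans (uC k) _; rewrite ler_wpM2l// lerXn2r ?nnegrE ?le_max ?lexx//.
    by rewrite ltW.
  by rewrite (ltW s0).
apply: le_trans (vD k) _; rewrite ler_wpM2l// lerXn2r ?nnegrE ?le_max ?lexx ?orbT//.
  by rewrite ltW.
by rewrite (ltW s0).
Qed.

Lemma geometric_decay_scale (R : realType) (u : nat -> R) (c : R) :
  geometric_decay u -> geometric_decay (fun k => c * u k).
Proof.
move=> [s s01 [C C0 uC]]; exists s => //; exists (`|c| * C); first by rewrite mulr_ge0.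
by move=> k; rewrite normrM -mulrA ler_wpM2l.
Qed.

Lemma geometric_decay0 (R : realType) : geometric_decay (fun=> 0 : R).
Proof.
exists 2^-1; first by rewrite invr_gt0 ltr0n invf_lt1 ?ltr0n ?ltr1n.
by exists 0 => // k; rewrite normr0 mul0r.
Qed.

Lemma geometric_decay_sum (R : realType) (I : finType) (u : I -> nat -> R) :
  (forall i, geometric_decay (u i)) ->
  geometric_decay (fun k => \sum_i u i k).
Proof.
move=> du; elim: (index_enum I) => [|i s IH].
  by under eq_fun do rewrite big_nil; exact: geometric_decay0.
under eq_fun do rewrite big_cons.
exact: geometric_decay_add.
Qed.

Lemma geometric_decay_summable (R : realType) (u : nat -> R) :
  geometric_decay u -> (forall k, 0 <= u k) ->
  (\sum_(0 <= k <oo) (u k)%:E < +oo)%E.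
Proof.
move=> [s /andP[s0 s1] [C C0 uC]] u0.
apply: (@le_lt_trans _ _ (C / (1 - s))%:E); last exact: ltry.
apply: lime_le; first by apply: is_cvg_ereal_nneg_natsum => k _; rewrite lee_fin.
near=> n; rewrite sumEFin lee_fin ler_pdivlMr ?subr_gt0//.
apply: (@le_trans _ _ (C * (1 - s ^+ n))); last first.
  by rewrite -[leRHS]mulr1 ler_wpM2l// lerBlDr lerDl exprn_ge0// ltW.
elim: {+}n => [|k IH]; first by rewrite big_geq// mul0r expr0 subrr mulr0.
rewrite big_nat_recr//= mulrDl.
have : u k <= C * s ^+ k by apply: le_trans (uC k); exact: ler_norm.
have : 0 < 1 - s by rewrite subr_gt0.
rewrite exprS => h1 h2; have := ler_wpM2r (ltW h1) h2; lra.
Unshelve. all: by end_near. Qed.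

(** * Powers of a matrix with a dominant eigenvalue *)

(** Multiplying [v *m (X - A) = (X - a) *: v] by the adjugate of [X - A] gives, at
    an index [j] with [v j != 0], that [v j * char_poly A = (X - a) * g] where [g]
    is the determinant of [X - A] with its [j]-th row replaced by [v]. At [X = a]
    that matrix kills [x], so that [a] is a root of [g] as well. *)
Lemma orthogonal_eigenvectors_multiple_root (F : fieldType) n (A : 'M[F]_n)
    (a : F) (v : 'rV[F]_n) (x : 'cV[F]_n) :
  v *m A = a *: v -> A *m x = a *: x -> v *m x = 0 -> v != 0 -> x != 0 ->
  (1 < mup a (char_poly A))%N.
Proof.
move=> vA Ax vx v0 x0.
have chi0 : char_poly A != 0 by rewrite monic_neq0// char_poly_monic.
have [j vj] : exists j, v 0 j != 0 by exact/rV0Pn.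
pose vP : 'rV[{poly F}]_n := map_mx polyC v.
pose g := (vP *m \adj (char_poly_mx A)) 0 j.
have vPA : vP *m char_poly_mx A = ('X - a%:P) *: vP.
  rewrite /char_poly_mx mulmxBr -map_mxM vA map_mxZ mul_mx_scalar scalerBl.
  by [].
have chiE : (v 0 j)%:P * char_poly A = ('X - a%:P) * g.
  have := congr1 (fun B => (B *m \adj (char_poly_mx A)) 0 j) vPA.
  rewrite -mulmxA mul_mx_adj mul_mx_scalar -scalemxAl !mxE -/(char_poly A).
  by rewrite mulrC => ->; congr (_ * _); rewrite /g mxE.
have ga : root g a.
  pose D := \matrix_(i, k) if i == j then v 0 k else (a%:M - A) i k.
  have D0 : \det D = 0.
    apply/eqP; rewrite -det_tr; apply/det0P; exists x^T.
      by apply: contra_neq x0 => /(congr1 trmx); rewrite trmxK trmx0.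
    apply: trmx_inj; rewrite trmx0 trmx_mul !trmxK; apply/colP => i.
    rewrite !mxE; under eq_bigr do rewrite mxE.
    have [ij|ij] := eqVneq i j; last first.
      have := congr1 (fun B : 'cV[F]_n => B i 0) (subrr (a *: x)).
      by rewrite -{2}Ax -mul_scalar_mx -mulmxBl mxE => ->; rewrite mxE.
    by have := congr1 (fun B : 'M[F]_(1, 1) => B 0 0) vx; rewrite !mxE.
  rewrite /root -D0 (expand_det_row _ j).
  have -> : g.[a] = (v *m \adj (a%:M - A)) 0 j.
    rewrite -[LHS]/(horner_eval a g) /g.
    have -> : horner_eval a ((vP *m \adj (char_poly_mx A)) 0 j) =
      (map_mx (horner_eval a) (vP *m \adj (char_poly_mx A))) 0 j by rewrite [RHS]mxE.
    rewrite map_mxM map_mx_adj; congr ((_ *m \adj _) 0 j).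
      by apply/rowP => i; rewrite /vP !mxE; exact: hornerC.
    apply/matrixP => i k; rewrite !mxE -[LHS]/(horner _ a) hornerD hornerN hornerC.
    by case: (i == k); rewrite ?mulr1n ?mulr0n ?hornerX ?hornerC.
  rewrite mxE; apply/eqP/eq_bigr => k _; rewrite /D !mxE eqxx; congr (_ * _).
  rewrite /cofactor; congr (_ * \det _); apply/matrixP => p q.
  by rewrite !mxE [lift j p == j]eq_sym (negPf (neq_lift j p)).
rewrite mup_geq// expr2.
have : ('X - a%:P) * ('X - a%:P) %| (v 0 j)%:P * char_poly A.
  by rewrite chiE dvdp_mul// dvdp_XsubCl.
by rewrite mul_polyC dvdpZr.
Qed.

Section ComplexModulus.
Variable R : realType.
Local Notation normc := (@Normc.normc R).
Local Notation C := (real_complex R).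

Lemma norm_normc (z : R[i]) : `|z| = C (normc z).
Proof. by case: z. Qed.

Lemma normc_ge0 z : 0 <= normc z.
Proof. by case: z => a b; rewrite sqrtr_ge0. Qed.

Lemma normc_real x : normc (C x) = `|x|.
Proof. by rewrite /= expr0n addr0 sqrtr_sqr. Qed.

Lemma ler_normcD (x y : R[i]) : normc (x + y) <= normc x + normc y.
Proof. exact: (@le_normcD R x y). Qed.

Lemma normc_lt (x y : R[i]) : (`|x| < `|y|) = (normc x < normc y).
Proof. by rewrite !norm_normc ltcR. Qed.

Definition spectrum n (A : 'M[R]_n) : set R[i] :=
  [set z : R[i] | eigenvalue (complexify A) z].

(** By the Cayley-Hamilton theorem the product of all the [A - z], [z] ranging over
    the eigenvalues, is zero. If [Q * (A - z) * A ^+ k] decays, then so does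
    [Q * A ^+ k], whose entries satisfy a first order recurrence with ratio [z]; all
    the factors can thus be removed. *)
Lemma geometric_decay_powers n (A : 'M[R]_n) :
  (forall z, spectrum A z -> normc z < 1) ->
  forall i j, geometric_decay (fun k => (A ^+ k) i j).
Proof.
case: n A => [|n] A sA; first by case.
pose B : 'M[R[i]]_n.+1 := map_mx C A.
have [zs zsE] := closed_field_poly_normal (char_poly B).
pose Q (s : seq R[i]) := horner_mx B (\prod_(z <- s) ('X - z%:P)).
have Q0 : Q zs = 0.
  have := Cayley_Hamilton B; rewrite {1}zsE.
  by rewrite (monicP (char_poly_monic B)) scale1r.
have zs1 z : z \in zs -> normc z < 1.
  move=> zzs; apply: sA; rewrite /spectrum /= eigenvalue_root_char -/B zsE.
  rewrite (monicP (char_poly_monic B)) scale1r root_prod_XsubC//.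
suff decayQ s : {subset s <= zs} ->
    (forall i j, geometric_decay (fun k => normc ((Q s * B ^+ k) i j))) ->
    forall i j, geometric_decay (fun k => normc ((B ^+ k) i j)).
  move=> i j; have [] := decayQ zs _ _ i j => //.
    move=> p q; congr geometric_decay: (geometric_decay0 R); apply/funext => k.
    by rewrite Q0 mul0r mxE /= expr0n addr0 sqrtr0.
  move=> t t01 [D D0 h]; exists t => //; exists D => // k.
  apply: le_trans (h k); rewrite -[B ^+ k]rmorphXn [X in normc X]mxE normc_real.
  by rewrite normr_id.
elim: s => [_ h i j|z s IH szs h].
  by congr geometric_decay: (h i j); apply/funext => k; rewrite /Q big_nil rmorph1 mul1r.
apply: IH => [w ws|i j]; first by apply: szs; rewrite inE ws orbT.
apply: (geometric_decay_recurrence (z := normc z)) (h i j) => [|k].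
  by rewrite normc_ge0 zs1// szs// mem_head.
have -> : (Q s * B ^+ k.+1) i j =
    z * (Q s * B ^+ k) i j + (Q (z :: s) * B ^+ k) i j.
  have -> : Q s * B ^+ k.+1 = z *: (Q s * B ^+ k) + Q (z :: s) * B ^+ k.
    have -> : Q (z :: s) = Q s * (B - z%:M).
      rewrite /Q big_cons mulrC rmorphM rmorphB /= horner_mx_X horner_mx_C.
      by [].
    have zC (X : 'M[R[i]]_n.+1) : X * z%:M = z *: X by exact: mul_mx_scalar.
    by rewrite mulrBr mulrBl exprS mulrA zC -scalerAl addrC subrK.
  by rewrite !mxE.
by rewrite !ger0_norm ?normc_ge0// -Normc.normcM ler_normcD.
Qed.
End ComplexModulus.

Section DominantEigenvalue.
Variables (R : realType) (n : nat) (A : 'M[R]_n) (lam : R).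
Variables (l : 'rV[R]_n) (r : 'cV[R]_n).
Hypothesis A0 : forall i j, 0 <= A i j.
Hypothesis hlam : dominant_eigenvalue A lam%:C%C.
Hypothesis hlr : eigenpair A lam l r.
Local Notation normc := (@Normc.normc R).

Let l0 : forall i, 0 <= l 0 i. Proof. by case: hlr => [[]]. Qed.
Let r0 : forall i, 0 <= r i 0. Proof. by case: hlr => [[]]. Qed.
Let lA : l *m A = lam *: l. Proof. by case: hlr. Qed.
Let Ar : A *m r = lam *: r. Proof. by case: hlr. Qed.
Let lr : (l *m r) 0 0 = 1. Proof. by case: hlr. Qed.

Lemma eigenpair_neq0 : exists2 i, 0 < l 0 i & 0 < r i 0.
Proof.
have : (l *m r) 0 0 != 0 by rewrite lr oner_neq0.
rewrite mxE psumr_neq0; last by move=> i _; rewrite mulr_ge0.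
by move=> /hasP[i _ /=]; rewrite mulr_ge0_gt0// => /andP[]; exists i.
Qed.

Lemma dominant_simple (v : 'rV[R[i]]_n) (x : 'cV[R[i]]_n) :
  v *m complexify A = lam%:C%C *: v -> complexify A *m x = lam%:C%C *: x ->
  v *m x = 0 -> v = 0 \/ x = 0.
Proof.
move=> vA Ax vx; have [->|v0] := eqVneq v 0; first by left.
have [->|x0] := eqVneq x 0; first by right.
have := orthogonal_eigenvectors_multiple_root vA Ax vx v0 x0.
by case: hlam => _ _ ->.
Qed.

(** If [lam] were [0], all eigenvalues would vanish, and then [0] would be a root of
    multiplicity [n > 1]. *)
Lemma dominant_gt0 : (1 < n)%N -> 0 < lam.
Proof.
move=> n1; have [i li ri] := eigenpair_neq0.
rewrite lt_neqAle; apply/andP; split; last first.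
  rewrite -(pmulr_lge0 _ ri); have := congr1 (fun B : 'cV[R]_n => B i 0) Ar.
  rewrite /= [RHS]mxE => <-; rewrite mxE sumr_ge0// => j _.
  by rewrite mulr_ge0.
apply/eqP => lam0; case: hlam => _ Hmax Hmup.
pose B := complexify A.
have [zs zsE] := closed_field_poly_normal (char_poly B).
rewrite (monicP (char_poly_monic B)) scale1r in zsE.
have chi0 : char_poly B != 0 by rewrite monic_neq0// char_poly_monic.
have zs0 z : z \in zs -> z = 0.
  move=> zzs; apply/eqP; apply: contraT => z0.
  have : eigenvalue B z by rewrite eigenvalue_root_char zsE root_prod_XsubC.
  by move=> /Hmax; rewrite -lam0 => /(_ z0); rewrite normr0 normr_lt0.
have : size (char_poly B) = n.+1 by rewrite size_char_poly.
rewrite zsE size_prod_XsubC => -[szs].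
case: zs zsE zs0 szs => [|a [|b s]] zsE zs0 szs; rewrite -szs// in n1.
have : (1 < mup lam%:C%C (char_poly B))%N.
  have a0 : a = 0 by apply: zs0; rewrite mem_head.
  have b0 : b = 0 by apply: zs0; rewrite !inE eqxx orbT.
  have lamC0 : lam%:C%C = 0 by rewrite -lam0.
  rewrite (mup_geq _ _ chi0) zsE !big_cons a0 b0 lamC0 mulrA -expr2.
  exact: dvdp_mulIl.
by rewrite Hmup.
Qed.

(** [x] minus its component along [r] is an eigenvector orthogonal to [l]. *)
Lemma dominant_right_unique (x : 'cV[R]_n) :
  A *m x = lam *: x -> x = (l *m x) 0 0 *: r.
Proof.
move=> Ax; set c := (l *m x) 0 0.
have vl : complexify l *m complexify A = lam%:C%C *: complexify l.
  by rewrite -map_mxM lA map_mxZ.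
have vx : complexify A *m complexify (x - c *: r) =
    lam%:C%C *: complexify (x - c *: r).
  rewrite -map_mxM mulmxBr -scalemxAr Ax Ar scalerA mulrC -scalerA -scalerBr.
  by rewrite map_mxZ.
have lx0 : complexify l *m complexify (x - c *: r) = 0.
  rewrite -map_mxM mulmxBr -scalemxAr [l *m x]mx11_scalar [l *m r]mx11_scalar.
  by rewrite lr -/c scale_scalar_mx mulr1 subrr map_mx0.
have [/eqP|/eqP] := dominant_simple vl vx lx0; rewrite map_mx_eq0.
  by move=> /eqP le0; have [k] := eigenpair_neq0; rewrite le0 mxE ltxx.
by rewrite subr_eq0 => /eqP.
Qed.

(** The decay of the powers of the deflated matrix [A / lam - r *m l]. *)
Lemma dominant_powers_decay : 0 < lam -> forall i j,
  geometric_decay (fun k => lam ^- k * (A ^+ k) i j - r i 0 * l 0 j).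
Proof.
move=> lam0 i j; have lamN0 : lam != 0 by rewrite gt_eqF.
pose P := r *m l; pose B := lam^-1 *: A - P.
have Br : B *m r = 0.
  rewrite mulmxBl -scalemxAl Ar scalerA mulVf// scale1r -mulmxA.
  by rewrite [l *m r]mx11_scalar lr mulmx1 subrr.
have PP : P *m P = P.
  by rewrite mulmxA -(mulmxA r) [l *m r]mx11_scalar lr mulmx1.
have PA : P *m A = lam *: P by rewrite -mulmxA lA -scalemxAr.
have AP : A *m P = lam *: P by rewrite mulmxA Ar -scalemxAl.
have Bk k : B ^+ k.+1 = lam ^- k.+1 *: A ^+ k.+1 - P.
  elim: k => [|k IH]; first by rewrite !expr1.
  rewrite exprSr IH -[LHS]/(_ *m _) /B mulmxBl !mulmxBr -!scalemxAl -!scalemxAr.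
  rewrite PA PP !scalerA mulVf// scale1r subrr subr0.
  have -> : A ^+ k.+1 *m P = lam ^+ k.+1 *: P.
    elim: {IH} k.+1 => [|m IH]; first by rewrite expr0 mul1mx scale1r.
    by rewrite exprSr -mulmxA AP -scalemxAr IH scalerA -exprS.
  rewrite scalerA mulVf ?expf_neq0// scale1r; congr (_ *: _ - _).
    by rewrite -invfM -exprSr.
  by rewrite [RHS]exprSr.
have sB z : spectrum B z -> normc z < 1.
  move=> /eigenvalueP[v vB v0].
  have [->|z0] := eqVneq z 0; first by rewrite Normc.normc0.
  have vr : v *m complexify r = 0.
    apply: (scalerI z0); rewrite scaler0 scalemxAl -vB -mulmxA -map_mxM Br.
    by rewrite /complexify map_mx0 mulmx0.
  have vA : v *m complexify A = (lam%:C%C * z) *: v.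
    have -> : A = lam *: (B + P) by rewrite subrK scalerA mulfV// scale1r.
    rewrite /complexify map_mxZ map_mxD map_mxM -scalemxAr mulmxDr mulmxA vr.
    by rewrite mul0mx addr0 -/(complexify _) vB scalerA.
  have lamC : (lam%:C)%C != 0 by rewrite fmorph_eq0.
  have [z1|z1] := eqVneq (lam%:C%C * z) lam%:C%C.
    rewrite z1 in vA.
    have Arc : complexify A *m complexify r = lam%:C%C *: complexify r.
      by rewrite -map_mxM Ar map_mxZ.
    have [v00|/eqP] := dominant_simple vA Arc vr; first by rewrite v00 eqxx in v0.
    rewrite map_mx_eq0 => /eqP r00.
    by have [p _] := eigenpair_neq0; rewrite r00 mxE ltxx.
  case: hlam => _ /(_ (lam%:C%C * z)) Hmax _.
  have : eigenvalue (complexify A) (lam%:C%C * z) by apply/eigenvalueP; exists v.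
  move=> /Hmax /(_ z1); rewrite normc_lt Normc.normcM !normc_real gtr_pMr//.
  by rewrite normr_gt0.
have [s s01 [C C0 sC]] := geometric_decay_powers sB i j.
apply: (@geometric_decay_recurrence _
  (fun k => lam ^- k * (A ^+ k) i j - r i 0 * l 0 j)
  (fun k => (B ^+ k.+1) i j) 0).
- by rewrite lexx ltr01.
- move=> k; rewrite mul0r add0r Bk !mxE big_ord1; exact: lexx.
exists s => //; exists C => // k; apply: le_trans (sC k.+1) _.
case/andP: s01 => s0 s1.
by rewrite ler_wpM2l// exprS ger_pMl ?exprn_gt0// ltW.
Qed.

End DominantEigenvalue.

(** * Transience of states from which a closed set is reached *)
Section Transience.
Variables (R : realType) (N : nat) (P : 'M[R]_N) (i : 'I_N) (C : set 'I_N).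
Hypothesis Pst : stochastic P.
Hypothesis Ccl : forall j k, C j -> 0 < P j k -> C k.
Hypothesis iC : ~ C i.

Let P0 j k : 0 <= P j k.
Proof. by have [/(_ k)] := Pst j; rewrite mxE. Qed.

Let P1 j : \sum_k P j k = 1.
Proof. by have [_ <-] := Pst j; apply: eq_bigr => k _; rewrite mxE. Qed.

(** Probability, starting from [j], to be in [C] at time [m] without having visited
    [i] at the times [1, ..., m]. *)
Fixpoint avoiding_prob (m : nat) (j : 'I_N) : R :=
  if m is m'.+1 then \sum_(k | k != i) P j k * avoiding_prob m' k
  else (j \in C)%:R.

(** Probability, starting from [j], to visit [i] at one of the times
    [1, ..., n]. *)
Definition visit_prob (n : nat) (j : 'I_N) : R :=
  \sum_(0 <= m < n) first_visit P i m j.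

Let visit_prob0 j : visit_prob 0 j = 0.
Proof. by rewrite /visit_prob big_geq. Qed.

Let visit_probS n j :
  visit_prob n.+1 j = P j i + \sum_(k | k != i) P j k * visit_prob n k.
Proof.
rewrite /visit_prob big_nat_recl//=; congr (_ + _).
rewrite exchange_big/=; apply: eq_bigr => k _.
by rewrite mulr_sumr.
Qed.

Let PC j k : C j -> ~ C k -> P j k = 0.
Proof.
move=> Cj Ck; apply/eqP; rewrite eq_le P0 andbT leNgt.
by apply/negP => /(Ccl Cj).
Qed.

Lemma visit_prob_closed n j : C j -> visit_prob n j = 0.
Proof.
elim: n j => [//|n IH] j Cj; rewrite visit_probS PC// add0r big1// => k _.
have [Ck|Ck] := pselect (C k); first by rewrite IH// mulr0.
by rewrite (PC Cj Ck) mul0r.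
Qed.

Let split_i j : 1 = P j i + \sum_(k | k != i) P j k.
Proof. by rewrite -(P1 j) (bigD1 i). Qed.

Lemma visit_prob_le1 n j : visit_prob n j <= 1.
Proof.
elim: n j => [|n IH] j; first by rewrite visit_prob0.
rewrite visit_probS [leRHS](split_i j) lerD2l ler_sum// => k _.
by rewrite -[leRHS]mulr1 ler_wpM2l.
Qed.

(** Paths that are in the closed set [C] at time [m] and have avoided [i] until then
    never visit [i]. *)
Lemma visit_avoiding_le1 m n j : visit_prob n j + avoiding_prob m j <= 1.
Proof.
elim: m n j => [|m IH] n j.
  rewrite /=; have [Cj|Cj] := pselect (C j).
    by rewrite visit_prob_closed// mem_set// add0r.
  by rewrite memNset// addr0 visit_prob_le1.
case: n => [|n].
  rewrite visit_prob0 add0r /= [leRHS](split_i j).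
  apply: le_trans (_ : \sum_(k | k != i) P j k <= _); last by rewrite lerDr.
  rewrite ler_sum// => k _; rewrite -[leRHS]mulr1 ler_wpM2l//.
  by have := IH 0%N k; rewrite visit_prob0 add0r.
rewrite visit_probS /= -addrA -big_split /= [leRHS](split_i j) lerD2l.
rewrite ler_sum// => k _; rewrite -mulrDr -[leRHS]mulr1 ler_wpM2l//.
Qed.

Lemma avoiding_prob_ge0 m j : 0 <= avoiding_prob m j.
Proof.
elim: m j => [|m IH] j /=; first by rewrite ler0n.
by apply: sumr_ge0 => k _; rewrite mulr_ge0.
Qed.

(** A shortest path from [i] to [C] does not come back to [i]. The induction avoids
    choosing one: were all these probabilities zero, then [C] could not be reached
    at time [n] from any state from which it is not reached while avoiding [i]. *)
Lemma avoiding_prob_gt0 m j : C j -> 0 < (P ^+ m) i j ->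
  exists n, 0 < avoiding_prob n i.
Proof.
move=> Cj Pm; apply: contrapT => /forallNP q0.
have {}q0 n : avoiding_prob n i = 0.
  apply/eqP; rewrite eq_le avoiding_prob_ge0 andbT leNgt.
  exact/negP/q0.
suff H n k : avoiding_prob n k = 0 -> forall j, C j -> (P ^+ n) k j = 0.
  by move: Pm; rewrite (H m i)// ltxx.
elim: n k => [|n IH] k /=.
  case: (boolP (k \in C)) => [_ /eqP|]; first by rewrite oner_eq0.
  move=> kC _ j' Cj'; rewrite expr0 mxE; case: eqP => // kj.
  by move: kC; rewrite kj mem_set.
move=> qk j' Cj'; rewrite exprS -[LHS]/((P *m P ^+ n) k j') mxE big1// => p _.
have [->|pi] := eqVneq p i; first by rewrite (IH i)// mulr0.
have /eqP := qk; rewrite psumr_eq0; last first.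
  by move=> p' _; rewrite mulr_ge0// avoiding_prob_ge0.
move=> /allP /(_ p); rewrite mem_index_enum => /(_ isT).
rewrite pi /= mulf_eq0 => /orP[/eqP->|/eqP qp]; first by rewrite mul0r.
by rewrite (IH p)// mulr0.
Qed.

Lemma transient_to_closed m j : C j -> 0 < (P ^+ m) i j -> transient P i.
Proof.
move=> Cj /(avoiding_prob_gt0 Cj)[n q0].
apply: (@le_lt_trans _ _ (1 - avoiding_prob n i)%:E); last first.
  by rewrite lte_fin ltrBlDr ltrDl.
have f0 p k : 0 <= first_visit P i p k.
  elim: p k => [|p IH] k //=; apply: sumr_ge0 => ? _.
  by rewrite mulr_ge0.
apply: lime_le.
  by apply: is_cvg_ereal_nneg_natsum => p _; rewrite lee_fin.
near=> p; rewrite sumEFin lee_fin lerBrDr.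
exact: visit_avoiding_le1.
Unshelve. all: by end_near. Qed.

End Transience.

(** * The Doob transform of a matrix by an eigenvector *)
Section DoobTransform.
Variables (R : realType) (N : nat) (A : 'M[R]_N) (lam : R).
Variables (l : 'rV[R]_N) (r : 'cV[R]_N) (P : 'M[R]_N).
Hypothesis A0 : forall i j, 0 <= A i j.
Hypothesis lam0 : 0 < lam.
Hypothesis l0 : forall i, 0 <= l 0 i.
Hypothesis r0 : forall i, 0 <= r i 0.
Hypothesis Ar : A *m r = lam *: r.
Hypothesis Acvg : forall i j,
  lam ^- k * (A ^+ k) i j @[k --> \oo] --> r i 0 * l 0 j.
Hypothesis PE : forall i, r i 0 != 0 ->
  forall j, P i j = lam^-1 * A i j * (r j 0 / r i 0).

Lemma exp_mx_ge0 m i j : 0 <= (A ^+ m) i j.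
Proof.
elim: m i j => [|m IH] i j; first by rewrite expr0 mxE ler0n.
rewrite exprS -[X in 0 <= X]/((A *m A ^+ m) i j) mxE sumr_ge0// => k _.
by rewrite mulr_ge0.
Qed.

Lemma exp_mx_eigen m : A ^+ m *m r = lam ^+ m *: r.
Proof.
elim: m => [|m IH]; first by rewrite !expr0 mul1mx scale1r.
by rewrite exprS -mulmxA IH -scalemxAr Ar scalerA -exprSr.
Qed.

(** The zeros of [r] do not lead to states where [r] is positive, so that no term
    passing through such a zero contributes to a power of [P] in [doob_exp]. *)
Lemma exp_mx_eigen0 m i j : r i 0 = 0 -> (A ^+ m) i j * r j 0 = 0.
Proof.
move=> ri; have := congr1 (fun B : 'cV[R]_N => B i 0) (exp_mx_eigen m).
rewrite /= [RHS]mxE ri mulr0 mxE => /eqP; rewrite psumr_eq0; last first.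
  by move=> k _; rewrite mulr_ge0// exp_mx_ge0.
by move=> /allP /(_ j); rewrite mem_index_enum => /(_ isT) /eqP.
Qed.

Lemma doob_exp m i j : r i 0 != 0 ->
  (P ^+ m) i j = lam ^- m * (A ^+ m) i j * (r j 0 / r i 0).
Proof.
elim: m i j => [|m IH] i j ri.
  rewrite !expr0 invr1 mul1r !mxE; case: eqP => [<-|]; last by rewrite mul0r.
  by rewrite mul1r divff.
rewrite [P ^+ _]exprS [A ^+ _]exprS -[LHS]/((P *m P ^+ m) i j).
rewrite -[X in _ = _ * X * _]/((A *m A ^+ m) i j) !mxE.
rewrite mulr_sumr mulr_suml; apply: eq_bigr => k _; rewrite PE//.
have [rk|rk] := eqVneq (r k 0) 0.
  transitivity (lam ^- m.+1 * A i k * (r i 0)^-1 * ((A ^+ m) k j * r j 0)).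
    by rewrite exp_mx_eigen0// rk !mul0r !mulr0 mul0r.
  by ring.
rewrite IH// exprS invfM; field.
by rewrite ri rk expf_neq0 ?gt_eqF.
Qed.

Lemma doob_cvg i j : r i 0 != 0 ->
  (P ^+ m) i j @[m --> \oo] --> l 0 j * r j 0.
Proof.
move=> ri; have -> : l 0 j * r j 0 = r i 0 * l 0 j * (r j 0 / r i 0).
  by field.
under eq_fun do rewrite doob_exp//.
by apply: cvgM; [exact: Acvg|exact: cvg_cst].
Qed.

Lemma doob_eventually_gt0 i j : r i 0 != 0 -> 0 < l 0 j * r j 0 ->
  exists m, forall k, (m <= k)%N -> 0 < (P ^+ k) i j.
Proof.
move=> ri lj; have := @doob_cvg i j ri.
move=> /cvgr_gt /(_ 0 lj) [m _ mP].
by exists m => k mk; apply: mP.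
Qed.

(** From any state of [C], each state of [C] is charged at all large times; two
    consecutive return times have gcd [1]. *)
Lemma doob_ergodic (C : set 'I_N) : (forall i, C i -> 0 < l 0 i * r i 0) ->
  ergodic_on C P.
Proof.
move=> C0; have rC i : C i -> r i 0 != 0.
  by move=> /C0; apply: contraTneq => ->; rewrite mulr0 ltxx.
split=> [i j /rC ri /C0 lj|i Ci d dP].
  by have [m mP] := doob_eventually_gt0 ri lj; exists m; exact: mP.
have [m mP] := doob_eventually_gt0 (rC i Ci) (C0 i Ci).
have d1 := dP m.+1 isT (mP m.+1 (leqnSn m)).
have d2 := dP m.+2 isT (mP m.+2 (leqW (leqnSn m))).
by apply/eqP; rewrite -dvdn1 -(dvdn_addr _ d1) addn1.
Qed.

Hypothesis lA : l *m A = lam *: l.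
Hypothesis lr : (l *m r) 0 0 = 1.

Lemma doob_stochastic_row i : r i 0 != 0 -> prob_vector (row i P).
Proof.
move=> ri; split=> [j|].
  by rewrite mxE PE// mulr_ge0// ?mulr_ge0 ?invr_ge0 ?(ltW lam0).
under eq_bigr do rewrite mxE PE// mulrA.
rewrite -mulr_suml; under eq_bigr do rewrite -mulrA.
rewrite -mulr_sumr; have := congr1 (fun B : 'cV[R]_N => B i 0) Ar.
rewrite /= mxE [RHS]mxE => ->.
by field; rewrite ri gt_eqF.
Qed.

(** A stationary [p] satisfies [p = p *m P ^+ m], whose limit is
    [\sum_i p i * (l * r) = l * r]. Closedness of [C] ensures that invariance on
    [C] is invariance everywhere. *)
Lemma doob_stationary (C : set 'I_N) :
  (forall i, C i -> r i 0 != 0) ->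
  (forall i j, C i -> 0 < P i j -> C j) ->
  (forall i, l 0 i * r i 0 != 0 -> C i) ->
  forall p, stationary_on C P p <-> p = \row_i (l 0 i * r i 0).
Proof.
move=> rC clC lC p.
have P0 i j : C i -> 0 <= P i j.
  by move=> /rC /doob_stochastic_row[/(_ j)]; rewrite mxE.
have sumC (q : 'rV[R]_N) (B : 'M[R]_N) j : (forall i, ~ C i -> q 0 i = 0) ->
    \sum_(i | i \in C) q 0 i * B i j = (q *m B) 0 j.
  move=> qC; rewrite mxE [RHS](bigID (fun i => i \in C)) /= [X in _ + X]big1 ?addr0//.
  by move=> i /negP iC; rewrite qC ?mul0r// => Ci; apply: iC; rewrite mem_set.
split=> [[[p0 p1] pC pP]|->].
  have pPp : p *m P = p.
    apply/rowP => j; have [Cj|Cj] := pselect (C j); first by rewrite -pP// sumC.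
    rewrite (pC j Cj) mxE big1// => i _.
    have [Ci|Ci] := pselect (C i); last by rewrite pC// mul0r.
    suff -> : P i j = 0 by rewrite mulr0.
    apply/eqP; rewrite eq_le P0// andbT leNgt; apply/negP => /(clC _ _ Ci).
    exact: Cj.
  have pPm m : p *m P ^+ m = p.
    elim: m => [|m IH]; first by rewrite expr0 mulmx1.
    by rewrite exprSr mulmxA IH.
  apply/rowP => j; rewrite mxE.
  have h : (p *m P ^+ m) 0 j @[m --> \oo] --> \sum_i p 0 i * (l 0 j * r j 0).
    under eq_fun do rewrite mxE.
    apply: cvg_big => [|i _]; first exact: add_continuous.
    have [Ci|Ci] := pselect (C i).
      by apply: cvgM; [exact: cvg_cst|exact/doob_cvg/rC].
    by rewrite pC// mul0r; under eq_fun do rewrite mul0r; exact: cvg_cst.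
  move: h; under eq_fun do rewrite pPm.
  rewrite -mulr_suml p1 mul1r => /(cvg_lim _) <- //.
  by rewrite lim_cst.
have piC i : ~ C i -> (\row_i (l 0 i * r i 0) : 'rV[R]_N) 0 i = 0.
  by move=> Ci; rewrite mxE; apply/eqP/negPn/negP => /lC.
split=> //.
  split=> [i|]; first by rewrite mxE mulr_ge0.
  by rewrite -lr mxE; apply: eq_bigr => i _; rewrite mxE.
move=> j Cj; rewrite sumC// !mxE.
have := congr1 (fun B : 'rV[R]_N => B 0 j) lA; rewrite /= mxE [RHS]mxE => lAj.
rewrite -[RHS]mul1r -(mulVf (lt0r_neq0 lam0)) -mulrA (mulrA lam) -lAj.
rewrite mulr_suml mulr_sumr; apply: eq_bigr => i _; rewrite mxE.
have [ri|ri] := eqVneq (r i 0) 0.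
  have := @exp_mx_eigen0 1 i j ri; rewrite expr1 => h.
  by rewrite ri mulr0 mul0r -mulrA h !mulr0.
by rewrite PE//; field; rewrite ri gt_eqF.
Qed.

End DoobTransform.

(** * Positivity of the eigenvectors of primitive matrices *)
Section PrimitivePositivity.
Variables (R : realType) (n : nat) (A : 'M[R]_n) (lam : R).
Hypothesis Aprim : primitive A.
Hypothesis lam0 : 0 < lam.

Lemma primitive_right_gt0 (x : 'cV[R]_n) : A *m x = lam *: x ->
  (forall i, 0 <= x i 0) -> x != 0 -> forall i, 0 < x i 0.
Proof.
move=> Ax x0 /cV0Pn[j xj] i; have [m _ Am] := Aprim.
have := congr1 (fun B : 'cV[R]_n => B i 0) (exp_mx_eigen Ax m).
rewrite /= [RHS]mxE => h.
rewrite -(pmulr_rgt0 _ (exprn_gt0 m lam0)) -h mxE.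
have xj0 : 0 < x j 0 by rewrite lt0r xj x0.
rewrite (bigD1 j)//=; apply: ltr_pwDl; first by rewrite mulr_gt0.
by apply: sumr_ge0 => k _; rewrite mulr_ge0// ltW.
Qed.

Lemma primitive_left_gt0 (x : 'rV[R]_n) : x *m A = lam *: x ->
  (forall i, 0 <= x 0 i) -> x != 0 -> forall i, 0 < x 0 i.
Proof.
move=> xA x0 /rV0Pn[j xj] i; have [m _ Am] := Aprim.
have xAm : x *m A ^+ m = lam ^+ m *: x.
  elim: m {Am} => [|m IH]; first by rewrite !expr0 mulmx1 scale1r.
  by rewrite exprSr mulmxA IH -scalemxAl xA scalerA -exprSr.
have := congr1 (fun B : 'rV[R]_n => B 0 i) xAm; rewrite /= [RHS]mxE => h.
rewrite -(pmulr_rgt0 _ (exprn_gt0 m lam0)) -h mxE.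
have xj0 : 0 < x 0 j by rewrite lt0r xj x0.
rewrite (bigD1 j)//=; apply: ltr_pwDl; first by rewrite mulr_gt0.
by apply: sumr_ge0 => k _; rewrite mulr_ge0// ltW.
Qed.

End PrimitivePositivity.

(** * Sums of weights over paths *)
Section PathWeight.
Variables (R : realType) (N : nat) (A : 'M[R]_N).

(** Recursion on the sequence, with the first state singled out, makes sums over
    tuples unfold like matrix powers. *)
Fixpoint path_weight (a : 'I_N) (s : seq 'I_N) : R :=
  if s is b :: s' then A a b * path_weight b s' else 1.

Lemma path_weightE a s :
  path_weight a s = \prod_(m < size s) A (nth a (a :: s) m) (nth a s m).
Proof.
elim: s a => [|b s IH] a; first by rewrite big_ord0.
rewrite /= big_ord_recl /= IH; congr (_ * _); apply: eq_bigr => m _.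
by congr (A _ _); apply: set_nth_default; rewrite //= ltnS ltnW.
Qed.

Lemma path_weight_rcons a s b :
  path_weight a (rcons s b) = path_weight a s * A (last a s) b.
Proof. by elim: s a => [|c s IH] a /=; rewrite ?mulr1 ?mul1r// IH mulrA. Qed.

Lemma sum_tupleS (T : finType) k (Q : pred (seq T)) (F : seq T -> R) :
  \sum_(z : k.+1.-tuple T | Q z) F z =
  \sum_a \sum_(s : k.-tuple T | Q (a :: s)) F (a :: s).
Proof.
rewrite pair_big_dep /=.
rewrite (reindex (fun p : T * k.-tuple T => [tuple of p.1 :: p.2])) //=.
exists (fun z => (thead z, [tuple of behead z])) => [[a s] _|z _] /=.
  by rewrite theadE; congr pair; exact/val_inj.
by rewrite -tuple_eta.
Qed.

Lemma sum_path_weight_prefix (g : 'cV[R]_N) y k a : (size y <= k)%N ->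
  \sum_(s : k.-tuple 'I_N | prefix y s) path_weight a s * g (last a s) 0 =
  path_weight a y * (A ^+ (k - size y) *m g) (last a y) 0.
Proof.
elim: k y a => [|k IH] y a yk.
  case: y yk => // _; rewrite (big_pred1 [tuple]) /=.
    by rewrite expr0 mul1mx.
  by move=> s; rewrite prefix0s (tuple0 s); apply/esym/eqP.
rewrite (@sum_tupleS _ _ (fun s => prefix y s)
  (fun s => path_weight a s * g (last a s) 0)) /=.
case: y yk => [|b y] yk /=.
  under eq_bigr do (under eq_bigr do rewrite -mulrA; rewrite -mulr_sumr).
  rewrite subn0 mul1r exprS -mulmxA mxE; apply: eq_bigr => c _.
  congr (_ * _); have := IH [::] c (leq0n k); rewrite subn0 mul1r => <-.
  by apply: eq_bigl => s; rewrite prefix0s.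
rewrite (bigD1 b)//= [X in _ + X]big1 ?addr0 => [|c cb]; last first.
  by rewrite big_pred0// => s; rewrite eq_sym (negPf cb).
under eq_bigl do rewrite eqxx /=.
under eq_bigr do rewrite -mulrA.
by rewrite -mulr_sumr IH// subSS mulrA.
Qed.

Lemma sum_path_weight (g : 'cV[R]_N) k a :
  \sum_(s : k.-tuple 'I_N) path_weight a s * g (last a s) 0 =
  (A ^+ k *m g) a 0.
Proof.
have := @sum_path_weight_prefix g [::] k a (leq0n k); rewrite subn0 mul1r => <-.
by apply: eq_bigl => s; rewrite prefix0s.
Qed.

End PathWeight.

Section WeightedPaths.
Variables (R : realType) (N : nat) (G : cwg R N).
Local Notation A := (cwM G).

Lemma weightE k (z : k.+1.-tuple 'I_N) : weight G z =
  cwI G 0 (thead z) * path_weight A (thead z) (behead z) *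
  cwF G (last (thead z) (behead z)) 0.
Proof.
have tE m : tnth z m = nth (thead z) z m by rewrite (tnth_nth (thead z)).
have zE : thead z :: behead z = z by rewrite [in RHS](tuple_eta z).
rewrite /weight; congr (_ * _ * _).
- rewrite path_weightE size_behead size_tuple /=.
  apply: eq_bigr => m _; rewrite zE !tE !inordK ?ltnS ?(ltnW (ltn_ord m))//.
  by rewrite -[in X in A _ X]zE.
- by rewrite tE (last_nth (thead z)) size_behead size_tuple zE.
Qed.

Lemma weight_path k (z : k.+1.-tuple 'I_N) : weight G z != 0 -> @is_path _ _ G k z.
Proof.
rewrite /weight !mulf_eq0 !negb_or => /andP[/andP[_ /prodf_neq0 zp] _].
by apply/forallP => m; rewrite lt0r zp// cwM_ge0.
Qed.

(** Sequences that are not paths have weight zero. *)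
Lemma sum_kpath k (Q : pred (k.+1.-tuple 'I_N)) :
  \sum_(z : kpath G k | Q (val z)) weight G (val z) =
  \sum_(z : k.+1.-tuple 'I_N | Q z) weight G z.
Proof.
rewrite [RHS](bigID (@is_path _ _ G k)) /= [X in _ = _ + X]big1 ?addr0; last first.
  by move=> z /andP[_ zp]; apply/eqP/negPn; exact: contra (@weight_path _ z) zp.
rewrite (reindex_omap (val : kpath G k -> _) insub) /=.
  apply: eq_bigl => z; rewrite (valP z) andbT valK eqxx andbT.
  by [].
by move=> z /andP[_ zp]; rewrite insubT.
Qed.

Lemma sum_weight_prefix k (a : 'I_N) (s : seq 'I_N) : (size s <= k)%N ->
  \sum_(z : kpath G k | prefix (a :: s) (val z)) weight G (val z) =
  cwI G 0 a * path_weight A a s *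
  (A ^+ (k - size s) *m cwF G) (last a s) 0.
Proof.
move=> sk; rewrite (@sum_kpath k (fun z => prefix (a :: s) z)).
under eq_bigr do rewrite weightE -mulrA.
pose F (z : seq 'I_N) := cwI G 0 (head a z) *
  (path_weight A (head a z) (behead z) * cwF G (last (head a z) (behead z)) 0).
rewrite (eq_bigr (fun z : k.+1.-tuple 'I_N => F z)); last first.
  by move=> [[|b z] sz] _.
rewrite (@sum_tupleS _ _ _ (fun z => prefix (a :: s) z) F).
rewrite (bigD1 a)//= [X in _ + X]big1 ?addr0 => [|c cb]; last first.
  by rewrite big_pred0// => z; rewrite eq_sym (negPf cb).
under eq_bigl do rewrite eqxx /=.
by rewrite /F /= -mulr_sumr sum_path_weight_prefix// mulrA.
Qed.

Lemma partition_funE k : partition_fun G k = (cwI G *m A ^+ k *m cwF G) 0 0.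
Proof.
rewrite /partition_fun (@sum_kpath k xpredT).
under eq_bigr do rewrite weightE -mulrA.
rewrite -mulmxA mxE.
have a0 := default_state G.
pose F (z : seq 'I_N) := cwI G 0 (head a0 z) *
  (path_weight A (head a0 z) (behead z) * cwF G (last (head a0 z) (behead z)) 0).
rewrite (eq_bigr (fun z : k.+1.-tuple 'I_N => F z)); last first.
  by move=> [[|b z] sz] _.
rewrite (@sum_tupleS _ _ _ xpredT F); apply: eq_bigr => a _.
by rewrite /F /= -mulr_sumr sum_path_weight.
Qed.

Definition cylinder (s : seq 'I_N) : set (Omega G) :=
  [set x | forall n, (n < size s)%N -> val x n = onth s n].

Lemma pad_cylinder k (z : kpath G k) s : cylinder s (pad z) <-> prefix s (val z).
Proof.
suff H (t : seq 'I_N) :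
    (forall n, (n < size s)%N -> onth t n = onth s n) <-> prefix s t by exact: H.
elim: s t => [|a s IH] [|b t] /=; split=> //.
- by move=> /(_ 0%N isT).
- move=> H; have [->] := H 0%N isT; rewrite eqxx /=.
  by apply/IH => n ns; exact: (H n.+1).
- move=> /andP[/eqP -> /IH H] [//|n]; exact: H.
Qed.

Lemma wdist_sum k (B : set (Omega G)) :
  wdist G k B = ((\sum_(z : kpath G k | pad z \in B) weight G (val z))
                  / partition_fun G k)%:E.
Proof.
rewrite /wdist (bigID (fun z => pad z \in B)) /= [X in (_ + X)%E]big1 ?adde0.
  rewrite mulr_suml -sumEFin; apply: eq_bigr => z zB.
  by rewrite diracE zB mule1.
by move=> z zB; rewrite diracE (negPf zB) mule0.
Qed.

Lemma wdist_cylinder k (a : 'I_N) (s : seq 'I_N) : (size s <= k)%N ->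
  wdist G k (cylinder (a :: s)) =
  (cwI G 0 a * path_weight A a s *
  (A ^+ (k - size s) *m cwF G) (last a s) 0 / partition_fun G k)%:E.
Proof.
move=> sk; rewrite wdist_sum -sum_weight_prefix//; congr (_ / _)%:E.
by apply: eq_bigl => z; apply/idP/idP => [/set_mem/pad_cylinder|
  /pad_cylinder/mem_set].
Qed.

Lemma wdist_dead k m : (m <= k)%N ->
  wdist G k [set x | val x m = None] = 0%E.
Proof.
move=> mk; rewrite wdist_sum big_pred0 ?mul0r// => z.
apply/negP => /set_mem /=.
case: z => -[z /= /eqP zk] _ /=; rewrite onthE.
by move=> /(congr1 isSome); rewrite (nth_map (head (default_state G) z)) ?zk.
Qed.

End WeightedPaths.

(** * Topology of path space *)
Section PathTopology.
Variables (R : realType) (N : nat) (G : cwg R N).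

Definition agree (m : nat) (x y : padded_seq N) :=
  forall n, (n < m)%N -> y n = x n.

Lemma nbhs_agree m (x : padded_seq N) : nbhs x (agree m x).
Proof.
have -> : agree m x =
    \big[setI/setT]_(n < m) ((fun y : padded_seq N => y n) @^-1` [set x n]).
  rewrite -(@bigcap_mkord _ m (fun n => (fun y : padded_seq N => y n) @^-1` [set x n])).
  by apply/seteqP; split => y H n /= ?; exact: H.
apply: (@big_ind _ (fun B => nbhs x B)) => //; first exact: filterT.
  by move=> ? ?; exact: filterI.
move=> n _; apply: (@proj_continuous nat (fun=> discrete_topology (option 'I_N)) n x).
exact: discrete_set1.
Qed.

(** The filter of the sets [agree m x] converges to [x] coordinatewise, hence in the
    product topology. *)
Lemma nbhs_agreeP (x : padded_seq N) (U : set (padded_seq N)) :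
  nbhs x U -> exists m, agree m x `<=` U.
Proof.
pose F := filter_from [set: nat] (fun m => agree m x).
have FF : Filter F.
  apply: filter_from_filter; first by exists 0%N.
  move=> i j _ _; exists (maxn i j) => // y yx; split => n ni; apply: yx.
    by rewrite leq_max ni.
  by rewrite leq_max ni orbT.
have : F --> x.
  apply/(@pointwise_cvgP _ _ F x) => n B Bx.
  exists n.+1 => // y yx /=; rewrite yx//; exact: nbhs_singleton.
by move=> H /H [m _ mU]; exists m.
Qed.

Lemma compact_padded_path : compact (padded_path G).
Proof.
have cT : compact [set: padded_seq N].
  have oc : compact [set: discrete_topology (option 'I_N)].
    apply: finite_compact.
    exact: (@finite_finset (option 'I_N) setT
      : finite_set [set: discrete_topology (option 'I_N)]).
  have := @tychonoff nat (fun=> discrete_topology (option 'I_N))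
    (fun=> setT) (fun=> oc).
  by congr compact; apply/seteqP; split.
apply: subclosed_compact cT _ => //.
move=> x clx.
have ap m : exists2 y, padded_path G y & agree m x y.
  by have [y [Py yx]] := clx _ (nbhs_agree m x); exists y.
split=> [|m].
  by have [y [y0 _] yx] := ap 1%N; rewrite -(yx 0%N).
by have [y [_ /(_ m) yP] yx] := ap m.+2; rewrite -!yx// ltnW.
Qed.

Lemma nbhs_OmegaP (x : Omega G) (U : set (Omega G)) :
  nbhs x U <-> exists m, [set y : Omega G | agree m (val x) (val y)] `<=` U.
Proof.
split=> [[V [[B oB <-] Bx BU]]|[m mU]].
  have [m mB] := nbhs_agreeP (open_nbhs_nbhs (conj oB Bx)).
  by exists m => y /mB; exact: BU.
apply: filterS mU _.
have := nbhs_agree m (val x); rewrite nbhsE => -[B [oB Bx] BU].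
exists (val @^-1` B); split => //; first by exists B.
by move=> y; exact: BU.
Qed.

(** Near-covering compactness, for the property that [f] oscillates by less than [e]
    on the cylinder of depth [m] around a given point. *)
Lemma Omega_uniformly_continuous (f : Omega G -> R) (e : R) :
  continuous f -> 0 < e ->
  exists m, forall x y : Omega G, agree m (val x) (val y) -> `|f x - f y| < e.
Proof.
move=> fc e0.
have /compact_near_coveringP := compact_padded_path.
move=> /(_ nat \oo (fun m x => forall x' y' : Omega G, val x' = x ->
  agree m (val x') (val y') -> `|f x' - f y'| < e) _).
case=> [x Px|m _ mP]; last first.
  exists m => x y xy; apply: (mP m (leqnn m) (val x)) xy => //.
  exact: set_mem (valP x).
pose x0 : Omega G := exist _ x (mem_set Px).
have : nbhs x0 [set y | `|f x0 - f y| < e / 2].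
  have := fc x0 _ (nbhsx_ballx (f x0) (e / 2) _).
  by rewrite divr_gt0// => /(_ isT); exact.
move=> /nbhs_OmegaP[m mf].
exists (agree m x, [set k | (m <= k)%N]).
  by split; [exact: nbhs_agree|exists m].
move=> [z k] [/= xz mk] x' y' x'z x'y'.
have x'E n : val x' n = z n by exact: (congr1 (fun g : padded_seq N => g n) x'z).
have h1 : `|f x0 - f x'| < e / 2 by apply: mf => n nm; rewrite x'E xz.
have h2 : `|f x0 - f y'| < e / 2.
  apply: mf => n nm; transitivity (val x' n).
    exact: x'y' (leq_trans nm mk).
  by rewrite x'E xz.
have -> : f x' - f y' = - (f x0 - f x') + (f x0 - f y') by ring.
by rewrite (le_lt_trans (ler_normD _ _))// normrN (splitr e) ltrD.
Qed.

End PathTopology.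

(** * Weak convergence tested on cylinders *)
Section WeakConvergence.
Variables (R : realType) (N : nat) (G : cwg R N).
Local Notation T := (borelType (Omega G)).

Lemma open_borel (B : set (Omega G)) : open B -> measurable (B : set T).
Proof. by move=> oB; exact: sub_sigma_algebra. Qed.

Lemma measurable_local m (B : set (Omega G)) :
  (forall x y : Omega G, agree m (val x) (val y) -> B x -> B y) ->
  measurable (B : set T).
Proof.
move=> Bm; apply: open_borel; rewrite openE => x Bx.
by apply/nbhs_OmegaP; exists m => y /Bm; exact.
Qed.

Definition dead m : set (Omega G) := [set x | val x m = None].

Lemma measurable_dead m : measurable (dead m : set T).
Proof.
by apply: (@measurable_local m.+1) => x y xy; rewrite /dead /= xy.
Qed.

Lemma measurable_cylinder s : measurable (cylinder s : set T).
Proof.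
by apply: (@measurable_local (size s)) => x y xy xs n ns; rewrite xy// xs.
Qed.

Lemma measurable_fun_continuous (f : Omega G -> R) :
  continuous f -> measurable_fun setT (f : T -> R).
Proof.
move=> /continuousP cf; apply: (measurability _ (RGenOpens.measurableE R)).
move=> _ [_ [a [b ->] <-]]; rewrite setTI; apply: open_borel.
by apply: cf; exact: interval_open.
Qed.

Lemma dead_le n m (x : Omega G) : (n <= m)%N -> dead n x -> dead m x.
Proof.
move=> /subnK <- xn; elim: (m - n)%N => [//|k IH].
have [_ /(_ (k + n)%N)] := set_mem (valP x); move: IH.
by rewrite /dead /= addSn => ->; case: (sval x _).
Qed.

Lemma cylinder_alive m (x : Omega G) : ~ dead m x ->
  exists z : kpath G m, cylinder (val z) x.
Proof.
move=> xm.
have xn n : (n <= m)%N -> val x n <> None.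
  by move=> nm xN; apply: xm; exact: dead_le nm xN.
pose z := [tuple odflt (default_state G) (val x i) | i < m.+1].
have zx (i : 'I_m.+1) : val x i = Some (tnth z i).
  rewrite tnth_mktuple; have := xn i (ltn_ord i).
  by case: (val x i).
have zP : @is_path _ _ G m z.
  apply/forallP => i; have [_ /(_ i)] := set_mem (valP x).
  have h1 := zx (inord i); have h2 := zx (inord i.+1).
  rewrite inordK ?ltnS 1?ltnW// in h1; rewrite inordK ?ltnS// in h2.
  by rewrite h1 h2.
exists (exist _ z zP) => n nz.
have nm : (n < m.+1)%N by rewrite -(size_tuple z).
rewrite (zx (Ordinal nm)) onthE (nth_map (default_state G)) ?size_tuple//.
by rewrite (tnth_nth (default_state G)).
Qed.

Lemma cylinder_disjoint k (z w : k.-tuple 'I_N) (x : Omega G) :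
  cylinder z x -> cylinder w x -> z = w :> k.-tuple 'I_N.
Proof.
move=> zx wx; apply: eq_from_tnth => i; have := zx i; have := wx i.
rewrite !size_tuple ltn_ord => /(_ isT) -> /(_ isT).
rewrite !onthE !(nth_map (tnth z i)) ?size_tuple// => -[].
by rewrite -!tnth_nth.
Qed.

(** Almost surely the path is alive at time [m], and then it lies in exactly one of
    the cylinders, on which [f] is within [e] of its value at the path that is
    truncated after time [m]. *)
Lemma integral_cylinder_approx (nu : {measure set T -> \bar R})
    (f : Omega G -> R) (e : R) m :
  nu setT = 1%E -> nu (dead m) = 0%E -> continuous f -> bounded_fun f ->
  (forall x y : Omega G, agree m.+1 (val x) (val y) -> `|f x - f y| < e) ->
  (`| \int[nu]_x (f x)%:E -
     \sum_(z : kpath G m) (f (pad z))%:E * nu (cylinder (val z)) | <= e%:E)%E.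
Proof.
move=> nu1 nud cf bf fe.
have nufin : (nu setT < +oo)%E by rewrite nu1 ltry.
have mf := measurable_fun_continuous cf.
have bint (h : T -> R) : measurable_fun setT h -> bounded_fun h ->
    nu.-integrable setT (EFin \o h).
  by move=> mh bh; exact: measurable_bounded_integrable.
pose g (z : kpath G m) (x : T) : R := f (pad z) * \1_(cylinder (val z)) x.
have mg z : measurable_fun setT (g z).
  apply: measurable_funM; first exact: measurable_cst.
  by apply: measurable_indic; exact: measurable_cylinder.
have bg z : bounded_fun (g z).
  exists `|f (pad z)|; split; first exact: num_real.
  move=> M fM x _; apply: le_trans (ltW fM); rewrite /g normrM.
  by rewrite ler_piMr// indicE; case: (_ \in _); rewrite ?normr0 ?normr1.
have intg z : nu.-integrable setT (EFin \o g z) by exact: bint.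
have int_g z : (\int[nu]_x (g z x)%:E = (f (pad z))%:E * nu (cylinder (val z)))%E.
  under eq_integral do rewrite EFinM.
  rewrite integralZl//=; last first.
    apply: bint; first by apply: measurable_indic; exact: measurable_cylinder.
    exists 1; split; first exact: num_real.
    move=> M M1 x _; apply: le_trans (ltW M1).
    by rewrite indicE; case: (_ \in _); rewrite ?normr0 ?normr1.
  by rewrite integral_indic ?setIT//; exact: measurable_cylinder.
under eq_bigr do rewrite -int_g.
rewrite -(@integral_sum _ _ _ nu _ measurableT _ (fun z => EFin \o g z))//.
have intG : nu.-integrable setT (fun x => (\sum_z (g z x)%:E)%E).
  by apply: integrable_sum => // z _; exact: intg.
rewrite -integralB//; last by exact: bint.
have mB : measurable_fun setT
    ((EFin \o (f : T -> R)) \- (fun x => (\sum_z (g z x)%:E)))%E.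
  apply: emeasurable_funB; first exact/measurable_EFinP.
  by apply: measurable_int intG.
apply: le_trans (le_abse_integral _ _ _) _ => //.
apply: (@le_trans _ _ (\int[nu]_(x in setT) (cst e%:E) x)%E); last first.
  by rewrite integral_cst// nu1 mule1.
apply: ae_ge0_le_integral => //.
- exact: measurableT_comp.
- have e0 : 0 <= e.
    have := fe point point (fun _ _ => erefl).
    by rewrite subrr normr0 => /ltW.
  by move=> x _; rewrite lee_fin.
exists (dead m); split => //; first exact: measurable_dead.
move=> x /=; apply: contra_notP => /cylinder_alive[z xz] _.
rewrite sumEFin -EFinB abse_EFin lee_fin.
rewrite (bigD1 z)//= big1 ?addr0 => [|w wz]; last first.
  rewrite /g indicE memNset ?mulr0// => xw.
  move: wz => /eqP; apply; apply/val_inj; exact: cylinder_disjoint xw xz.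
rewrite /g indicE mem_set// mulr1 distrC; apply/ltW/fe => n nm.
have /pad_cylinder zz : prefix (val z) (val z) by exact: prefix_refl.
by rewrite xz ?size_tuple// (zz n) ?size_tuple.
Qed.

Lemma integral_cylinder_approx_fin (nu : {measure set T -> \bar R})
    (f : Omega G -> R) (e : R) m :
  nu setT = 1%E -> nu (dead m) = 0%E -> continuous f -> bounded_fun f ->
  (forall x y : Omega G, agree m.+1 (val x) (val y) -> `|f x - f y| < e) ->
  (\int[nu]_x (f x)%:E)%E \is a fin_num /\
  `|fine (\int[nu]_x (f x)%:E)%E -
    \sum_(z : kpath G m) f (pad z) * fine (nu (cylinder (val z)))| <= e.
Proof.
move=> nu1 nud cf bf fe.
have := integral_cylinder_approx nu1 nud cf bf fe.
have nufin (z : kpath G m) : nu (cylinder (val z)) \is a fin_num.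
  rewrite ge0_fin_numE//; apply: (@le_lt_trans _ _ (nu setT)).
    by apply: le_measure; rewrite ?inE//; exact: measurable_cylinder.
  by rewrite nu1 ltry.
under eq_bigr do rewrite -(fineK (nufin _)) -EFinM.
by rewrite sumEFin; case: (integral _ _ _).
Qed.

Lemma weakly_cvg_cylinders (mus : nat -> {measure set T -> \bar R})
    (mu : {measure set T -> \bar R}) :
  (\forall k \near \oo, mus k setT = 1%E) -> mu setT = 1%E ->
  (forall m, \forall k \near \oo, mus k (dead m) = 0%E) ->
  (forall m, mu (dead m) = 0%E) ->
  (forall m (z : kpath G m),
     fine (mus k (cylinder (val z))) @[k --> \oo] -->
     fine (mu (cylinder (val z)))) ->
  weakly_cvg mus mu.
Proof.
move=> mus1 mu1 musd mud musc f cf bf.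
pose s (nu : {measure set T -> \bar R}) m :=
  \sum_(z : kpath G m) f (pad z) * fine (nu (cylinder (val z))).
have scvg m : s (mus k) m @[k --> \oo] --> s mu m.
  apply: cvg_big => [|z _]; first exact: add_continuous.
  by apply: cvgM; [exact: cvg_cst|exact: musc].
have approx e : 0 < e -> exists m, forall nu : {measure set T -> \bar R},
    nu setT = 1%E -> nu (dead m) = 0%E ->
    (\int[nu]_x (f x)%:E)%E \is a fin_num /\
    `|fine (\int[nu]_x (f x)%:E)%E - s nu m| <= e.
  move=> e0; have [m fm] := Omega_uniformly_continuous cf e0.
  exists m => nu nu1 nud; apply: integral_cylinder_approx_fin => // x y xy.
  by apply: fm => n nm; apply: xy; rewrite leqW.
have [m0 H0] := approx 1 ltr01.
have [If _] := H0 mu mu1 (mud m0).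
rewrite -(fineK If); apply/fine_cvgP; split.
  have md := musd m0.
  by near=> k; apply: (H0 (mus k) _ _).1; near: k.
apply/cvgrPdist_le => e e0.
have [m Hm] := approx (e / 3) (divr_gt0 e0 (ltr0Sn _ _)).
have [_ h1] := Hm mu mu1 (mud m).
have e3 : 0 < e / 3 by rewrite divr_gt0.
have /cvgrPdist_le /(_ _ e3) sm := scvg m.
have md := musd m.
near=> k.
have [|| _ h2] := Hm (mus k); [by near: k|by near: k|].
have h3 : `|s mu m - s (mus k) m| <= e / 3 by near: k.
set a := fine _ in h1 *; set b := fine _ in h2 *.
have -> : a - b = (a - s mu m) + (s mu m - s (mus k) m) - (b - s (mus k) m).
  by ring.
apply: le_trans (ler_normB _ _) _.
apply: le_trans (lerD (ler_normD _ _) (lexx _)) _.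
lra.
Unshelve. all: by end_near. Qed.

End WeakConvergence.

(** * Measures on path space with prescribed cylinder probabilities *)
Section UnitInterval.
Variable R : realType.

Definition unit_itv_measure :=
  mrestr (@lebesgue_measure R) (measurable_itv `[0 : R, 1[).

HB.instance Definition _ := Measure.copy unit_itv_measure
  (mrestr (@lebesgue_measure R) (measurable_itv `[0 : R, 1[)).

Let unit_itv_measureT : unit_itv_measure setT = 1%E.
Proof.
rewrite /unit_itv_measure /mrestr setTI lebesgue_measure_itv /=.
by rewrite lte_fin ltr01 oppr0 adde0.
Qed.

HB.instance Definition _ :=
  Measure_isProbability.Build _ _ _ unit_itv_measure unit_itv_measureT.

End UnitInterval.

(** A consistent family of weights [p] on words is realized by intervals: the
    interval of [s] starts at [left_end s], has length [p s], and is cut from left to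
    right into the intervals of the words [rcons s j]. *)
Section IntervalSubdivision.
Variables (R : realType) (N : nat) (p : seq 'I_N -> R) (a0 : 'I_N).
Hypothesis p0 : forall s, 0 <= p s.
Hypothesis p_nil : p [::] = 1.
Hypothesis p_rcons : forall s, p s = \sum_j p (rcons s j).

Definition left_end (s : seq 'I_N) : R :=
  \sum_(n < size s) \sum_(j : 'I_N | (j < nth a0 s n)%N) p (rcons (take n s) j).

Lemma left_end_rcons s j : left_end (rcons s j) =
  left_end s + \sum_(c : 'I_N | (c < j)%N) p (rcons s c).
Proof.
rewrite /left_end size_rcons big_ord_recr /=; congr (_ + _).
  apply: eq_bigr => n _; rewrite nth_rcons ltn_ord.
  by apply: eq_bigr => c _; rewrite -[rcons s j]cats1 takel_cat// ltnW.
by rewrite nth_rcons ltnn eqxx -[rcons s j]cats1 take_size_cat.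
Qed.

Definition in_itv_of (s : seq 'I_N) (u : R) : bool :=
  left_end s <= u < left_end s + p s.

Lemma in_itv_of_nil u : in_itv_of [::] u = (0 <= u < 1).
Proof. by rewrite /in_itv_of /left_end big_ord0 add0r p_nil. Qed.

(** The piece containing [u] is the one after which the partial sums of the lengths
    first exceed [u]. *)
Lemma in_itv_of_split s u : in_itv_of s u -> exists j, in_itv_of (rcons s j) u.
Proof.
move=> /andP[su us]; pose S n := left_end s + \sum_(c : 'I_N | (c < n)%N) p (rcons s c).
have exS : exists n, u < S n.
  exists N; rewrite (lt_le_trans us)// /S lerD2l p_rcons.
  by rewrite [leRHS](eq_bigl xpredT)// => c; rewrite ltn_ord.
have [n un nmin] := ex_minnP exS.
have S0 : S 0%N = left_end s by rewrite /S big_pred0 ?addr0.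
case: n un nmin => [|n] un nmin; first by rewrite S0 ltNge su in un.
have uSn : S n <= u by rewrite leNgt; apply/negP => /nmin; rewrite ltnn.
have nN : (n < N)%N.
  rewrite ltnNge; apply/negP => Nn; move: uSn; rewrite leNgt; case/negP.
  rewrite (lt_le_trans us)// /S lerD2l p_rcons.
  rewrite [leRHS](eq_bigl xpredT)// => c; rewrite (leq_trans (ltn_ord c) Nn)//.
exists (Ordinal nN); rewrite /in_itv_of left_end_rcons uSn /=.
apply: lt_le_trans un _; rewrite /S -addrA lerD2l.
rewrite (bigD1 (Ordinal nN))//= addrC lerD2r.
rewrite le_eqVlt; apply/orP; left; apply/eqP/eq_bigl => c; rewrite ltnS ltn_neqAle andbC.
by congr (_ && _).
Qed.

Lemma in_itv_of_rcons s j u : in_itv_of (rcons s j) u -> in_itv_of s u.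
Proof.
rewrite /in_itv_of left_end_rcons => /andP[h1 h2]; apply/andP; split.
  by apply: le_trans h1; rewrite lerDl sumr_ge0.
apply: lt_le_trans h2 _; rewrite -addrA lerD2l (p_rcons s).
rewrite [leRHS](bigID (fun c : 'I_N => (c < j)%N)) /= lerD2l.
by rewrite (bigD1 j) /= ?ltnn// lerDl sumr_ge0.
Qed.

Lemma in_itv_of_inj s t u : size s = size t ->
  in_itv_of s u -> in_itv_of t u -> s = t.
Proof.
elim/last_ind: s t => [|s j IH] t.
  by case: t.
elim/last_ind: t => [|t c _]; first by rewrite size_rcons.
rewrite !size_rcons => -[st] sju tcu.
have stE := IH t st (in_itv_of_rcons sju) (in_itv_of_rcons tcu).
move: tcu; rewrite -stE => scu {t st stE IH}; congr rcons.
wlog jc : j c sju scu / (j < c)%N.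
  move=> H; have [jc|cj|] := ltngtP j c; [exact: H|exact/esym/H|exact: val_inj].
exfalso; move: sju scu; rewrite /in_itv_of !left_end_rcons.
move=> /andP[_ h1] /andP[h2 _]; have := le_lt_trans h2 h1.
apply/negP; rewrite -leNgt -addrA lerD2l.
rewrite [leRHS](bigID (fun c : 'I_N => (c < j)%N)) /=.
rewrite [X in _ <= X + _](eq_bigl (fun c : 'I_N => (c < j)%N)); last first.
  move=> d; apply/andP/idP => [[]//|dj]; split=> //; exact: ltn_trans jc.
by rewrite lerD2l (bigD1 j) /= ?jc ?ltnn// lerDl sumr_ge0.
Qed.

(** The word of length [n] whose interval contains [u]. The letter [a0] is only used
    for [u] outside [0, 1[. *)
Fixpoint address (n : nat) (u : R) : seq 'I_N :=
  if n is m.+1 then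
    let s := address m u in
    rcons s (odflt a0 [pick j | in_itv_of (rcons s j) u])
  else [::].

Definition letter (n : nat) (u : R) : 'I_N := last a0 (address n.+1 u).

Lemma address_rcons n u : address n.+1 u = rcons (address n u) (letter n u).
Proof. by rewrite /letter /= last_rcons. Qed.

Lemma size_address n u : size (address n u) = n.
Proof. by elim: n => // n IH; rewrite /= size_rcons IH. Qed.

Lemma onth_address n m u : (m < n)%N -> onth (address n u) m = Some (letter m u).
Proof.
elim: n => // n IH; rewrite ltnS address_rcons leq_eqVlt => /orP[/eqP ->|mn].
  rewrite onthE (nth_map a0) ?size_rcons ?size_address//.
  by rewrite nth_rcons size_address ltnn eqxx.
rewrite -IH// !onthE !(nth_map a0) ?size_rcons ?size_address// ?leqW//.
by rewrite nth_rcons size_address mn.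
Qed.

Lemma address_in_itv n u : 0 <= u < 1 -> in_itv_of (address n u) u.
Proof.
move=> u01; elim: n => [|n IH]; first by rewrite in_itv_of_nil.
rewrite /=; case: pickP => [j //|nj] /=.
by have [j] := in_itv_of_split IH; rewrite nj.
Qed.

Lemma in_itv_of_unit s u : in_itv_of s u -> 0 <= u < 1.
Proof.
elim/last_ind: s => [|s j IH]; first by rewrite in_itv_of_nil.
by move=> /in_itv_of_rcons.
Qed.

(** The intervals of the words of a given length are pairwise disjoint. *)
Lemma addressP s u : 0 <= u < 1 -> (address (size s) u == s) = in_itv_of s u.
Proof.
move=> u01; apply/eqP/idP => [<-|su]; first exact: address_in_itv.
by apply: in_itv_of_inj su; rewrite ?size_address//; exact: address_in_itv.
Qed.

Lemma address_gt0 n u : 0 <= u < 1 -> 0 < p (address n u).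
Proof.
move=> /(address_in_itv n) /andP[h1 h2].
by have := le_lt_trans h1 h2; rewrite ltrDl.
Qed.

End IntervalSubdivision.

Section PathMeasure.
Variables (R : realType) (N : nat) (G : cwg R N) (p : seq 'I_N -> R).
Hypothesis p0 : forall s, 0 <= p s.
Hypothesis p_nil : p [::] = 1.
Hypothesis p_rcons : forall s, p s = \sum_j p (rcons s j).
Hypothesis p_path :
  forall s i j, 0 < p (rcons (rcons s i) j) -> 0 < cwM G i j.
Local Notation T := (borelType (Omega G)).
Local Notation a0 := (default_state G).

(** Points outside [0, 1[, a null set for Lebesgue measure restricted to [0, 1[, are
    sent to [0]: every real number then has an itinerary that is an infinite path. *)
Let clip (u : R) : R := if 0 <= u < 1 then u else 0.

Let clip01 u : 0 <= clip u < 1.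
Proof. by rewrite /clip; case: ifP => // _; rewrite lexx ltr01. Qed.

(** Addresses have positive weight, since their interval is not empty. *)
Lemma itinerary_subproof u :
  ((fun n => Some (letter p a0 n (clip u))) : padded_seq N) \in padded_path G.
Proof.
apply/mem_set; split => //= n; apply: (@p_path (address p a0 n (clip u))).
by rewrite -!address_rcons; exact: address_gt0.
Qed.

Definition itinerary (u : R) : Omega G :=
  exist _ ((fun n => Some (letter p a0 n (clip u))) : padded_seq N)
    (itinerary_subproof u).

Lemma itinerary_cylinder s u :
  cylinder s (itinerary u) <-> address p a0 (size s) (clip u) = s.
Proof.
split=> [h|<- n].
  apply: eq_from_onth_le => n; rewrite size_address maxnn => ns.
  by rewrite -h// onth_address.
by rewrite size_address => ns; rewrite onth_address.
Qed.

Let itv_of s : set R := `[left_end p a0 s, (left_end p a0 s + p s)%R[%classic.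

Let preimage_cylinder s : itinerary @^-1` cylinder s =
  (`[0, 1[%classic `&` itv_of s) `|`
  (~` `[0, 1[%classic `&`
   (if address p a0 (size s) 0 == s then setT else set0)).
Proof.
apply/seteqP; split => u /=.
  move=> /itinerary_cylinder; rewrite /clip; case: ifPn => u01 us.
    left; rewrite /= !in_itv /=; split=> //.
    by have := addressP a0 p0 p_nil p_rcons s u01; rewrite us eqxx => /esym.
  by right; rewrite in_itv /= us eqxx; split=> //; exact/negP.
rewrite !in_itv /= => -[[u01 us]|[u01 us]]; apply/itinerary_cylinder.
  by rewrite /clip u01; apply/eqP; rewrite addressP.
rewrite /clip; case: ifPn => // _.
by move: us; case: ifP => [/eqP|].
Qed.

(** An open set is the union of the cylinders that it contains, and there are only
    countably many of them. *)
Lemma measurable_itinerary :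
  measurable_fun setT (itinerary : measurableTypeR R -> T).
Proof.
have mcyl s : measurable (itinerary @^-1` cylinder s : set (measurableTypeR R)).
  rewrite preimage_cylinder; apply: measurableU; apply: measurableI.
  - exact: measurable_itv.
  - exact: measurable_itv.
  - by apply: measurableC; exact: measurable_itv.
  - by case: ifP => _; [exact: measurableT|exact: measurable0].
have mT : @measurable _ T = <<s @open (Omega G) >> by [].
apply: (measurability _ mT) => _ [U oU <-].
rewrite setTI.
have -> : itinerary @^-1` U = \bigcup_(s : seq 'I_N)
    (if `[< cylinder s `<=` U >] then itinerary @^-1` cylinder s else set0).
  apply/seteqP; split => u /=; last first.
    by move=> [s _]; case: asboolP => // sU /sU.
  move=> Uu; have := open_nbhs_nbhs (conj oU Uu).
  move=> /nbhs_OmegaP[m mU]; exists (address p a0 m (clip u)) => //.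
  have uu : cylinder (address p a0 m (clip u)) (itinerary u).
    by apply/itinerary_cylinder; rewrite size_address.
  rewrite asboolT// => y yu; apply: mU => n nm /=.
  by rewrite yu ?size_address// onth_address.
apply: countable_bigcupT_measurable => [|s]; first exact: countableP.
by case: ifP => _ //; exact: measurable0.
Qed.

(** The second clause expresses that the measure is carried by infinite paths in a
    form that applies to any measurable set containing them. *)
Lemma path_measure_exists : exists mu : probability T R,
  (forall s, mu (cylinder s) = (p s)%:E) /\
  (forall B : set T, measurable B -> infinite_paths G `<=` B -> mu B = 1%E).
Proof.
pose X : {mfun measurableTypeR R >-> T} :=
  HB.pack itinerary (isMeasurableFun.Build _ _ _ _ _ measurable_itinerary).
exists (distribution (@unit_itv_measure R) X); split=> [s|B mB iB].
  rewrite /distribution /pushforward /= /unit_itv_measure /mrestr.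
  rewrite -[X in X `&` _]/(itinerary @^-1` cylinder s) preimage_cylinder.
  have -> : (`[0, 1[ `&` itv_of s `|` ~` `[0, 1[ `&`
      (if address p a0 (size s) 0 == s then [set: R] else set0)) `&` `[0, 1[ =
      itv_of s.
    apply/seteqP; split=> u /=.
      by move=> [[[]|[+ _] +]].
    move=> us; have u01 : 0 <= u < 1.
      apply: (in_itv_of_unit (a0 := a0) p0 p_nil p_rcons (s := s)).
      by move: us; rewrite /itv_of /= in_itv.
    by split; [left; split|] => //; rewrite /= in_itv.
  rewrite lebesgue_measure_itv /= lte_fin; case: ifPn => h.
    by rewrite -EFinD addrAC subrr add0r.
  have : p s <= 0 by rewrite leNgt; apply: contra h; rewrite ltrDl.
  by move=> ps; congr (_%:E); apply/eqP; rewrite eq_le ps p0.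
have XB : itinerary @^-1` B = setT by apply/seteqP; split=> // u _; apply: iB.
transitivity (@unit_itv_measure R (itinerary @^-1` B)); first by [].
by rewrite XB probability_setT.
Qed.

End PathMeasure.

(** * Block triangular matrices *)
Section BlockTriangular.
Variables (R : realType) (K L : nat).
Variables (B : 'M[R]_K) (T : 'M[R]_(K, L)) (M : 'M[R]_L) (lam : R).
Variables (l : 'rV[R]_(K + L)) (r : 'cV[R]_(K + L)).
Local Notation A := (block_mx B T 0 M).
Hypothesis hlam : dominant_eigenvalue A lam%:C%C.
Hypothesis hlr : eigenpair A lam l r.
Hypothesis lam0 : 0 < lam.
Hypothesis Mprim : primitive M.
Hypothesis rhoBM : spectral_radius B < spectral_radius M.

Lemma char_poly_ublock : char_poly (complexify A) =
  char_poly (complexify B) * char_poly (complexify M).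
Proof.
rewrite /char_poly -(det_ublock _ (- map_mx polyC (complexify T))).
congr (\det _); rewrite /complexify map_block_mx /char_poly_mx map_mx0.
rewrite map_block_mx map_mx0 scalar_mx_block opp_block_mx add_block_mx.
by rewrite oppr0 addr0 add0r.
Qed.

Let spec_le z : spectrum A z -> complex.Re `|z| <= lam.
Proof.
move=> Az; have [->|zl] := eqVneq z lam%:C%C.
  by rewrite norm_normc normc_real /= ger0_norm// ltW.
case: hlam => _ /(_ z Az zl) + _; rewrite !norm_normc ltcR /= => /ltW.
by rewrite expr0n addr0 sqrtr_sqr ger0_norm// ltW.
Qed.

Let specB z : spectrum B z -> spectrum A z.
Proof.
rewrite /spectrum /= !eigenvalue_root_char char_poly_ublock rootM => ->.
by [].
Qed.

Let specM z : spectrum M z -> spectrum A z.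
Proof.
rewrite /spectrum /= !eigenvalue_root_char char_poly_ublock rootM => ->.
by rewrite orbT.
Qed.

(** Eigenvalues of both diagonal blocks are eigenvalues of [A], so that no modulus
    exceeds [lam]. If [lam] belonged to [B], the spectral radius of [B] would be
    maximal. *)
Lemma lam_notin_spectrumB : ~ spectrum B lam%:C%C.
Proof.
move=> Bl; move: rhoBM; apply/negP; rewrite -leNgt.
apply: (@le_trans _ _ lam).
  rewrite /spectral_radius.
  have [S0|S0] := eqVneq [set z : R[i] | eigenvalue (complexify M) z] set0.
    by rewrite S0 image_set0 sup0 ltW.
  apply: ge_sup.
    by move/set0P : S0 => [z Mz]; exists (complex.Re `|z|), z.
  by move=> _ [z Mz <-]; exact/spec_le/specM.
apply: ub_le_sup.
  by exists lam => _ [z Bz <-]; exact/spec_le/specB.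
by exists lam%:C%C => //; rewrite norm_normc normc_real /= ger0_norm// ltW.
Qed.

Let l1 := lsubmx l.
Let l2 := rsubmx l.
Let r2 := dsubmx r.

Let lA : row_mx (l1 *m B) (l1 *m T + l2 *m M) = row_mx (lam *: l1) (lam *: l2).
Proof.
have [_ + _ _] := hlr; rewrite -{1}[l]hsubmxK mul_row_block mulmx0 addr0 => ->.
by rewrite -scale_row_mx hsubmxK.
Qed.

Lemma block_left_eigen0 : l1 = 0.
Proof.
have [lB _] := eq_row_mx lA; apply/eqP; apply: contraT => l10.
exfalso; apply: lam_notin_spectrumB; apply/eigenvalueP.
exists (map_mx (real_complex R) l1); last by rewrite map_mx_eq0.
by rewrite -map_mxM lB map_mxZ.
Qed.

Let Mr2 : M *m r2 = lam *: r2.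
Proof.
have [_ _ + _] := hlr; rewrite -[r]vsubmxK mul_block_col scale_col_mx.
by move=> /eq_col_mx[_]; rewrite mul0mx add0r.
Qed.

Let l2M : l2 *m M = lam *: l2.
Proof. by have [_] := eq_row_mx lA; rewrite block_left_eigen0 mul0mx add0r. Qed.

Let lr2 : (l2 *m r2) 0 0 = 1.
Proof.
have [_ _ _] := hlr; rewrite -{1}[l]hsubmxK -{1}[r]vsubmxK mul_row_col.
by rewrite -/l1 block_left_eigen0 mul0mx add0r.
Qed.

Lemma block_left_lshift i : l 0 (lshift L i) = 0.
Proof. by have := congr1 (fun v : 'rV[R]_K => v 0 i) block_left_eigen0; rewrite !mxE. Qed.

Lemma block_eigenpair_rshift_gt0 i : 0 < l 0 (rshift K i) * r (rshift K i) 0.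
Proof.
have [[l0 r0] _ _ _] := hlr.
have l20 j : 0 <= l2 0 j by rewrite mxE.
have r20 j : 0 <= r2 j 0 by rewrite mxE.
have := @primitive_left_gt0 _ _ _ _ Mprim lam0 l2 l2M l20.
have := @primitive_right_gt0 _ _ _ _ Mprim lam0 r2 Mr2 r20.
have l2n : l2 != 0.
  by apply: contra_eq_neq lr2 => ->; rewrite mul0mx mxE eq_sym oner_eq0.
have r2n : r2 != 0.
  by apply: contra_eq_neq lr2 => ->; rewrite mulmx0 mxE eq_sym oner_eq0.
move=> /(_ r2n i) + /(_ l2n i); rewrite !mxE => ri li.
by rewrite mulr_gt0.
Qed.

Lemma block_exp_lower0 m (i : 'I_L) (j : 'I_K) :
  (A ^+ m) (rshift K i) (lshift L j) = 0.
Proof.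
elim: m i => [|m IH] i.
  by rewrite expr0 mxE eq_rlshift.
rewrite exprS -[LHS]/((A *m A ^+ m) _ _) mxE big_split_ord /= big1 ?add0r.
  by rewrite big1// => k _; rewrite IH mulr0.
by move=> k _; rewrite block_mxEdl mxE mul0r.
Qed.

End BlockTriangular.

Lemma case_B_structure (R : realType) N (G : cwg R N) K lam
    (l : 'rV[R]_N) (r : 'cV[R]_N) :
  dominant_eigenvalue (cwM G) lam%:C%C -> eigenpair (cwM G) lam l r ->
  0 < lam -> case_B G K ->
  [/\ exists i : 'I_N, (K <= i)%N,
      forall i : 'I_N, (i < K)%N -> l 0 i = 0,
      forall i : 'I_N, (K <= i)%N -> 0 < l 0 i * r i 0
    & forall m (i j : 'I_N), (K <= i)%N -> (j < K)%N -> (cwM G ^+ m) i j = 0].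
Proof.
move=> hlam hlr lam0 [L [eN [B [T [M [/andP[_ KN] AE Mprim rho [[i0 Ki0 _] _]]]]]]].
subst N; rewrite castmx_id in AE; rewrite AE in hlam hlr *.
have shift (i : 'I_(K + L)) : (exists k, i = lshift L k /\ (i < K)%N) \/
    (exists k, i = rshift K k /\ (K <= i)%N).
  by case: (split_ordP i) => k ->; [left|right]; exists k; rewrite /= ?leq_addr.
split.
- by exists i0.
- move=> i iK; have [[k [-> _]]|[k [_]]] := shift i; last by rewrite leqNgt iK.
  exact: (block_left_lshift hlam hlr lam0 rho).
- move=> i Ki; have [[k [_]]|[k [-> _]]] := shift i; first by rewrite ltnNge Ki.
  exact: (block_eigenpair_rshift_gt0 hlam hlr lam0 Mprim rho).
- move=> m i j Ki jK; have [[k [_]]|[k [-> _]]] := shift i; first by rewrite ltnNge Ki.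
  have [[k' [-> _]]|[k' [_]]] := shift j; last by rewrite leqNgt jK.
  exact: block_exp_lower0.
Qed.

(** * The limit of the weighted distributions *)
Section LimitChain.
Variables (R : realType) (N : nat) (G : cwg R N) (lam : R).
Variables (l : 'rV[R]_N) (r : 'cV[R]_N).
Hypothesis hlam : dominant_eigenvalue (cwM G) lam%:C%C.
Hypothesis hlr : eigenpair (cwM G) lam l r.
Local Notation A := (cwM G).
Local Notation wI := (cwI G).
Local Notation wF := (cwF G).
Local Notation T := (borelType (Omega G)).

Let l0 : forall i, 0 <= l 0 i. Proof. by case: hlr => [[]]. Qed.
Let r0 : forall i, 0 <= r i 0. Proof. by case: hlr => [[]]. Qed.
Let lA : l *m A = lam *: l. Proof. by case: hlr. Qed.
Let Ar : A *m r = lam *: r. Proof. by case: hlr. Qed.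
Let lr : (l *m r) 0 0 = 1. Proof. by case: hlr. Qed.
Let A0 := @cwM_ge0 _ _ G.
Let lam0 : 0 < lam. Proof. exact: dominant_gt0 A0 hlam hlr (cw_gt1 G). Qed.
Let wr0 : 0 < (wI *m r) 0 0. Proof. by have [] := cw_pos hlam hlr. Qed.
Let lw0 : 0 < (l *m wF) 0 0. Proof. by have [] := cw_pos hlam hlr. Qed.

Lemma exp_cwM_cvg i j :
  lam ^- k * (A ^+ k) i j @[k --> \oo] --> r i 0 * l 0 j.
Proof.
rewrite -[X in _ --> X]add0r.
have -> : (fun k => lam ^- k * (A ^+ k) i j) =
    (fun k => (lam ^- k * (A ^+ k) i j - r i 0 * l 0 j) + r i 0 * l 0 j).
  by apply/funext => k; rewrite subrK.
apply: cvgD; last exact: cvg_cst.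
apply: geometric_decay_cvg0; exact: dominant_powers_decay.
Qed.

Lemma exp_cwM_final_cvg i :
  lam ^- k * (A ^+ k *m wF) i 0 @[k --> \oo] --> r i 0 * (l *m wF) 0 0.
Proof.
rewrite mxE mulr_sumr.
under eq_fun do rewrite mxE mulr_sumr.
apply: cvg_big => [|j _]; first exact: add_continuous.
rewrite mulrA; under eq_fun do rewrite mulrA.
by apply: cvgM; [exact: exp_cwM_cvg|exact: cvg_cst].
Qed.

Lemma partition_fun_cvg :
  lam ^- k * partition_fun G k @[k --> \oo] --> (wI *m r) 0 0 * (l *m wF) 0 0.
Proof.
rewrite mxE mulr_suml.
under eq_fun do rewrite partition_funE -mulmxA mxE mulr_sumr.
apply: cvg_big => [|j _]; first exact: add_continuous.
rewrite -mulrA; under eq_fun do rewrite mulrCA.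
by apply: cvgM; [exact: cvg_cst|exact: exp_cwM_final_cvg].
Qed.

Lemma partition_fun_gt0 : \forall k \near \oo, 0 < partition_fun G k.
Proof.
have h : 0 < (wI *m r) 0 0 * (l *m wF) 0 0 by rewrite mulr_gt0.
have := partition_fun_cvg; move=> /cvgr_gt /(_ 0 h); apply: filterS => k.
by rewrite pmulr_rgt0// invr_gt0 exprn_gt0.
Qed.

Definition limit_prob (s : seq 'I_N) : R :=
  if s is a :: t then
    wI 0 a * path_weight A a t * r (last a t) 0 * lam ^- size t / (wI *m r) 0 0
  else 1.

Lemma path_weight_ge0 a s : 0 <= path_weight A a s.
Proof. by elim: s a => //= b s IH a; rewrite mulr_ge0. Qed.

Lemma limit_prob_ge0 s : 0 <= limit_prob s.
Proof.
case: s => [|a s] //=; apply: divr_ge0; last exact: ltW.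
rewrite mulr_ge0 ?invr_ge0 ?exprn_ge0 ?(ltW lam0)//.
by rewrite mulr_ge0// mulr_ge0 ?cwI_ge0 ?path_weight_ge0.
Qed.

Lemma row_eigen i : \sum_j A i j * r j 0 = lam * r i 0.
Proof. by have := congr1 (fun B : 'cV[R]_N => B i 0) Ar; rewrite !mxE. Qed.

Lemma limit_prob_rcons_cons a s j : limit_prob (rcons (a :: s) j) =
  wI 0 a * path_weight A a s * lam ^- (size s).+1 / (wI *m r) 0 0 *
  (A (last a s) j * r j 0).
Proof.
by rewrite /= path_weight_rcons last_rcons size_rcons; ring.
Qed.

Lemma limit_prob_sum s : limit_prob s = \sum_j limit_prob (rcons s j).
Proof.
case: s => [|a s].
  under eq_bigr do rewrite /= mulr1 expr0 invr1 mulr1.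
  by rewrite -mulr_suml -[X in X / _](_ : (wI *m r) 0 0 = _) ?divff ?gt_eqF// mxE.
under eq_bigr do rewrite limit_prob_rcons_cons.
rewrite -mulr_sumr row_eigen /= exprS; field.
by rewrite expf_neq0 ?gt_eqF.
Qed.

Lemma limit_prob_path s i j : 0 < limit_prob (rcons (rcons s i) j) -> 0 < A i j.
Proof.
move=> h; rewrite lt_neqAle A0 andbT eq_sym; apply: contraTneq h => Aij.
case: s => [|a s].
  by rewrite /= Aij !(mul0r, mulr0) ltxx.
by rewrite rcons_cons limit_prob_rcons_cons last_rcons Aij !(mul0r, mulr0) ltxx.
Qed.

Lemma wdist_cylinder_cvg a s :
  fine (wdist G k (cylinder (a :: s))) @[k --> \oo] --> limit_prob (a :: s).
Proof.
have Zcvg := partition_fun_cvg.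
have Zn0 : (wI *m r) 0 0 * (l *m wF) 0 0 != 0 by rewrite mulf_neq0 ?gt_eqF.
have -> : limit_prob (a :: s) =
    wI 0 a * path_weight A a s * (lam ^- size s * (r (last a s) 0 * (l *m wF) 0 0))
    / ((wI *m r) 0 0 * (l *m wF) 0 0).
  by rewrite /=; field; rewrite expf_neq0 ?gt_eqF.
have h1 : lam ^- k * (A ^+ (k - size s) *m wF) (last a s) 0 @[k --> \oo] -->
    lam ^- size s * (r (last a s) 0 * (l *m wF) 0 0).
  rewrite -(cvg_shiftn (size s)).
  have -> : (fun k => lam ^- (k + size s) *
      (A ^+ (k + size s - size s) *m wF) (last a s) 0) =
    (fun k => lam ^- size s * (lam ^- k * (A ^+ k *m wF) (last a s) 0)).
    by apply/funext => k; rewrite addnK exprD invfM; ring.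
  by apply: cvgM; [exact: cvg_cst|exact: exp_cwM_final_cvg].
have h2 : wI 0 a * path_weight A a s *
      (lam ^- k * (A ^+ (k - size s) *m wF) (last a s) 0) /
      (lam ^- k * partition_fun G k) @[k --> \oo] -->
    wI 0 a * path_weight A a s * (lam ^- size s * (r (last a s) 0 * (l *m wF) 0 0))
    / ((wI *m r) 0 0 * (l *m wF) 0 0).
  by apply: cvgM; [apply: cvgM; [exact: cvg_cst|exact: h1]|exact: cvgV].
apply: (cvg_trans _ h2); apply: near_eq_cvg.
near=> k.
have sk : (size s <= k)%N by near: k; exact: nbhs_infty_ge.
have Zk0 : 0 < partition_fun G k by near: k; exact: partition_fun_gt0.
have Zk : partition_fun G k != 0 by rewrite gt_eqF.
rewrite wdist_cylinder//=.
by field; rewrite Zk expf_neq0 ?gt_eqF.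
Unshelve. all: by end_near. Qed.

Variable mu : probability T R.
Hypothesis muC : forall s, mu (cylinder s) = (limit_prob s)%:E.
Hypothesis muI :
  forall B : set T, measurable B -> infinite_paths G `<=` B -> mu B = 1%E.

Lemma limit_dead m : mu (dead m) = 0%E.
Proof.
have md : measurable (dead m : set T) by exact: measurable_dead.
have mdC : measurable (~` (dead m : set T)) by exact: measurableC.
rewrite -(setCK (dead m)) probability_setC// muI ?subee//.
by move=> x /(_ m).
Qed.

Lemma limit_weakly_cvg : weakly_cvg (fun k => wdist G k) mu.
Proof.
apply: weakly_cvg_cylinders.
- by apply: filterS partition_fun_gt0 => k; exact: wdist_setT.
- exact: probability_setT.
- by move=> m; near=> k; apply: wdist_dead; near: k; exact: nbhs_infty_ge.
- exact: limit_dead.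
move=> m [[[|a s] zs] zP] //=.
have := @wdist_cylinder_cvg a s.
have -> : limit_prob (a :: s) = fine (mu (cylinder (a :: s))) by rewrite muC.
exact.
Unshelve. all: by end_near. Qed.

Lemma measurable_infinite : measurable (infinite_paths G : set T).
Proof.
have -> : infinite_paths G = \bigcap_m ~` dead m.
  apply/seteqP; split => x H m; first by move=> _; exact: H.
  by move=> xm; exact: (H m Logic.I xm).
apply: bigcapT_measurable => m; apply: measurableC; exact: measurable_dead.
Qed.

(** Dead paths are negligible, so that events may be compared on paths alive at some
    given time. This relates [nth_state], defined by a default value after death, to
    cylinders. *)
Lemma limit_eq_alive m (B C : set T) : measurable B -> measurable C ->
  (forall x, ~ dead m x -> B x <-> C x) -> mu B = mu C.
Proof.
wlog suff H : B C / measurable B -> measurable C ->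
    (forall x, ~ dead m x -> B x -> C x) -> (mu B <= mu C)%E.
  move=> mB mC BC; apply/eqP; rewrite eq_le !H// => x /BC[]//.
move=> mB mC BC; have md : measurable (dead m : set T) by exact: measurable_dead.
apply: (@le_trans _ _ (mu (C `|` dead m))).
  apply: le_measure; rewrite ?inE//; first exact: measurableU.
  by move=> x Bx; have [|xd] := pselect (dead m x); [right|left; exact: BC].
apply: le_trans (measureU2 _ _ _) _ => //.
have d0 : (mu (dead m) <= 0)%E by rewrite limit_dead.
by rewrite -[leRHS]adde0; apply: leeD.
Qed.

Lemma nth_state_alive m n (x : Omega G) : (n <= m)%N -> ~ dead m x ->
  val x n = Some (nth_state G n x).
Proof.
move=> nm xd; rewrite /nth_state; have : val x n <> None.
  by move=> xn; apply: xd; exact: dead_le nm xn.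
by case: (val x n).
Qed.

Lemma measurable_states m (Q : (nat -> 'I_N) -> Prop) :
  (forall s t, (forall n, (n <= m)%N -> s n = t n) -> Q s -> Q t) ->
  measurable ([set x | Q (fun n => nth_state G n x)] : set T).
Proof.
move=> QP; apply: (@measurable_local _ _ _ m.+1) => x y xy /=.
by apply: QP => n nm; rewrite /nth_state xy.
Qed.

Lemma limit_prob_states m (s : nat -> 'I_N) :
  mu [set x | forall n, (n <= m)%N -> nth_state G n x = s n] =
  (limit_prob (mkseq s m.+1))%:E.
Proof.
rewrite -muC; apply: (@limit_eq_alive m).
- apply: (@measurable_states m (fun t => forall n, (n <= m)%N -> t n = s n)).
  by move=> t u tu ts n nm; rewrite -tu// ts.
- exact: measurable_cylinder.
move=> x xd; split=> [H n|H n nm].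
  rewrite size_mkseq => nm; have nm' : (n <= m)%N by [].
  rewrite (nth_state_alive nm' xd) H//.
  by rewrite onthE (nth_map (s 0%N)) ?size_mkseq// nth_mkseq.
have := H n; rewrite size_mkseq ltnS => /(_ nm).
rewrite (nth_state_alive nm xd) onthE (nth_map (s 0%N)) ?size_mkseq//.
by rewrite nth_mkseq// => -[].
Qed.

Lemma limit_prob_state m i : mu (nth_state G m @^-1` [set i]) =
  (lam ^- m * (wI *m A ^+ m) 0 i * r i 0 / (wI *m r) 0 0)%:E.
Proof.
pose D := [set` [pred z : m.+1.-tuple 'I_N | last i z == i]].
transitivity (mu (\bigcup_(z in D) cylinder z)).
  apply: (@limit_eq_alive m).
  - apply: (@measurable_states m (fun t => t m = i)) => s t st <-.
    by rewrite st.
  - apply: fin_bigcup_measurable => [|z _]; first exact: finite_finset.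
    exact: measurable_cylinder.
  move=> x xd; split=> [xm|[z zm zx]].
    have [z zx] := cylinder_alive xd; exists (val z) => //=.
    have := zx m; rewrite size_tuple ltnSn => /(_ isT).
    rewrite (nth_state_alive (leqnn m) xd) xm onthE (nth_map i) ?size_tuple//.
    by move=> [zm]; rewrite /D /= inE -nth_last size_tuple; apply/eqP/esym.
  have := zx m; rewrite size_tuple ltnSn => /(_ isT).
  rewrite (nth_state_alive (leqnn m) xd) onthE (nth_map i) ?size_tuple//.
  move: zm; rewrite /D /= inE -nth_last size_tuple => /eqP /= zm [].
  by rewrite zm.
rewrite measure_fin_bigcup//; last 3 first.
- exact: finite_finset.
- move=> z w _ _ [x [zx wx]]; exact: cylinder_disjoint zx wx.
- by move=> z _; exact: measurable_cylinder.
rewrite /D -(@bigfs _ _ _ _ (index_enum _)) ?index_enum_uniq//; last first.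
  by move=> z _; rewrite mem_index_enum.
rewrite (eq_bigr (fun z : m.+1.-tuple 'I_N => (limit_prob z)%:E)); last first.
  by move=> z _; exact: muC.
rewrite sumEFin; congr (_%:E).
rewrite (@sum_tupleS _ _ _ (fun z => last i z == i) limit_prob) /=.
rewrite -[RHS]mulrA -[RHS]mulrA [RHS]mulrCA [(wI *m A ^+ m) 0 i]mxE mulr_suml.
apply: eq_bigr => a _.
have := @sum_path_weight _ _ A (delta_mx i 0) m a.
rewrite -colE mxE => <-; rewrite mulr_sumr mulr_suml big_mkcond /=.
apply: eq_bigr => s _; rewrite /limit_prob [delta_mx _ _ _ _]mxE eqxx andbT.
case: eqP => [->|_].
  by rewrite size_tuple mulr1; ring.
by rewrite !mulr0 mul0r.
Qed.

Local Notation X := (nth_state G).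

Lemma limit_reachableP i : reachable mu X i <->
  exists m, (wI *m A ^+ m) 0 i * r i 0 != 0.
Proof.
have h m : mu (X m @^-1` [set i]) <> 0%E <-> (wI *m A ^+ m) 0 i * r i 0 != 0.
  rewrite limit_prob_state; have cn : (wI *m r) 0 0 != 0 by rewrite gt_eqF.
  have ln : lam ^- m != 0 by rewrite invr_neq0// expf_neq0// gt_eqF.
  have E : (lam ^- m * (wI *m A ^+ m) 0 i * r i 0 / (wI *m r) 0 0 == 0) =
      ((wI *m A ^+ m) 0 i * r i 0 == 0).
    by rewrite mulf_eq0 invr_eq0 (negPf cn) orbF -mulrA mulf_eq0 (negPf ln).
  by rewrite -E; split=> [/eqP|/eqP H [] //]; rewrite eqe.
by split=> -[m /h]; exists m.
Qed.

Lemma limit_reachable_right i : reachable mu X i -> r i 0 != 0.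
Proof.
by move=> /limit_reachableP[m]; apply: contra_neq => ->; rewrite mulr0.
Qed.

Lemma initial_exp_cvg i :
  lam ^- k * (wI *m A ^+ k) 0 i @[k --> \oo] --> (wI *m r) 0 0 * l 0 i.
Proof.
rewrite mxE mulr_suml; under eq_fun do rewrite mxE mulr_sumr.
apply: cvg_big => [|j _]; first exact: add_continuous.
rewrite -mulrA; under eq_fun do rewrite mulrCA.
by apply: cvgM; [exact: cvg_cst|exact: exp_cwM_cvg].
Qed.

(** The probability of being in [i] at time [m] tends to [l i * r i]. *)
Lemma limit_reachable_stationary i : l 0 i * r i 0 != 0 -> reachable mu X i.
Proof.
rewrite mulf_eq0 negb_or => /andP[li ri]; apply/limit_reachableP.
have h : 0 < (wI *m r) 0 0 * l 0 i by rewrite mulr_gt0// lt0r li l0.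
have := @initial_exp_cvg i; move=> /cvgr_gt /(_ 0 h) [m _ /(_ m (leqnn m)) H].
exists m; rewrite mulf_neq0//; apply: contraTneq H => ->.
by rewrite mulr0 ltxx.
Qed.

Section TransitionMatrix.
Variable P : 'M[R]_N.
Hypothesis PE : transition_mx G lam r P.

Let PE1 i : r i 0 != 0 -> forall j, P i j = lam^-1 * A i j * (r j 0 / r i 0).
Proof. by have [+ _] := PE i. Qed.

Let Pst : stochastic P.
Proof.
move=> i; have [ri|ri] := eqVneq (r i 0) 0; first by have [_] := PE i; exact.
exact: (doob_stochastic_row A0 lam0 r0 Ar PE1).
Qed.

Lemma limit_reachable_closed i j :
  reachable mu X i -> 0 < P i j -> reachable mu X j.
Proof.
move=> Hi; have ri := limit_reachable_right Hi.
have [m] := (iffLR (limit_reachableP i)) Hi.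
rewrite mulf_eq0 negb_or => /andP[wi _]; rewrite PE1// => Pij.
have rj : r j 0 != 0 by apply: contraTneq Pij => ->; rewrite mul0r mulr0 ltxx.
have Aij : A i j != 0.
  by apply: contraTneq Pij => ->; rewrite mulr0 mul0r ltxx.
apply/limit_reachableP; exists m.+1; rewrite mulf_neq0//.
have wA0 k : 0 <= (wI *m A ^+ m) 0 k.
  rewrite mxE sumr_ge0// => q _.
  by rewrite mulr_ge0 ?cwI_ge0// (exp_mx_ge0 A0).
rewrite exprSr mulmxA mxE gt_eqF// (bigD1 i)//=; apply: ltr_pwDl.
  by rewrite mulr_gt0 ?lt0r ?wi ?wA0 ?Aij ?A0.
by rewrite sumr_ge0// => k _; rewrite mulr_ge0.
Qed.

Lemma limit_markov_chain : markov_chain mu X (initial_dist G r) P.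
Proof.
split.
- split=> //; split=> [i|].
    by rewrite mxE divr_ge0 ?(ltW wr0)// mulr_ge0 ?cwI_ge0.
  under eq_bigr do rewrite mxE.
  rewrite -mulr_suml -[X in X / _](_ : (wI *m r) 0 0 = _) ?divff ?gt_eqF//.
  by rewrite mxE.
- move=> m i; apply: (@measurable_states m (fun s => s m = i)) => s t st <-.
  by rewrite st.
- move=> i; rewrite limit_prob_state expr0 invr1 mul1r mulmx1; congr (_%:E).
  by rewrite [RHS]mxE.
move=> m s j past past0; rewrite /cond_prob.
have past_prob : mu past = (limit_prob (mkseq s m.+1))%:E.
  exact: limit_prob_states.
pose t n := if (n <= m)%N then s n else j.
have tE : mkseq t m.+2 = rcons (mkseq s m.+1) j.
  rewrite mkseqS /t ltnn; congr rcons; apply/eq_in_map => n.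
  by rewrite mem_iota /= add0n ltnS => ->.
have future_prob : mu (X m.+1 @^-1` [set j] `&` past) =
    (limit_prob (rcons (mkseq s m.+1) j))%:E.
  rewrite -tE -limit_prob_states; congr (mu _); apply/seteqP.
  split=> x /=.
    move=> [xj xp] n; rewrite /t leq_eqVlt ltnS => /orP[/eqP ->|nm].
      by rewrite ltnn.
    by rewrite nm xp.
  move=> H; split; first by rewrite H// /t ltnn.
  by move=> n nm; rewrite H ?leqW// /t nm.
move: past0; rewrite future_prob past_prob => past0.
have : limit_prob (mkseq s m.+1) != 0 by apply/eqP => z; apply: past0; rewrite z.
rewrite {past_prob future_prob past0 tE}.
have -> : mkseq s m.+1 = s 0%N :: [seq s n | n <- iota 1 m] by [].
have last_s : last (s 0%N) [seq s n | n <- iota 1 m] = s m.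
  by rewrite last_map; case: (m) => // k; rewrite -nth_last size_iota nth_iota.
rewrite limit_prob_rcons_cons.
set q := [seq s n | n <- iota 1 m] in last_s *.
move=> pn; have rs : r (s m) 0 != 0.
  by apply: contra_neq pn; rewrite /= last_s => ->; rewrite mulr0 !mul0r.
rewrite inver (negPf pn) -EFinM; congr (_%:E); rewrite PE1// last_s.
move: pn; rewrite /= last_s => pn.
move: (pn); rewrite !mulf_eq0 !negb_or !invr_eq0 => /andP[/andP[/andP[]]].
move=> /andP[wn qn] _ ln cn; rewrite exprS; field.
by rewrite wn qn ln cn rs gt_eqF.
Qed.

Lemma limit_exp i j m : r i 0 != 0 ->
  (P ^+ m) i j = lam ^- m * (A ^+ m) i j * (r j 0 / r i 0).
Proof. exact: doob_exp. Qed.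

Lemma limit_stationary (p : 'rV[R]_N) :
  stationary_on (reachable mu X) P p <-> p = \row_i (l 0 i * r i 0).
Proof.
apply: (doob_stationary A0 lam0 l0 r0 Ar exp_cwM_cvg PE1 lA lr).
- exact: limit_reachable_right.
- exact: limit_reachable_closed.
- exact: limit_reachable_stationary.
Qed.

Lemma limit_ergodic (C : set 'I_N) :
  (forall i, C i -> 0 < l 0 i * r i 0) -> ergodic_on C P.
Proof. exact: (doob_ergodic A0 lam0 r0 Ar exp_cwM_cvg PE1). Qed.

(** * Ergodic components *)
Lemma limit_case_A : case_A G -> ergodic_on setT P.
Proof.
move=> [Aprim _ _]; apply: limit_ergodic => i _.
have [k lk rk] := eigenpair_neq0 hlr.
rewrite mulr_gt0//.
  apply: (primitive_left_gt0 Aprim lam0 lA l0).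
  by apply/rV0Pn; exists k; rewrite gt_eqF.
apply: (primitive_right_gt0 Aprim lam0 Ar r0).
by apply/cV0Pn; exists k; rewrite gt_eqF.
Qed.

Section CaseB.
Variable K : nat.
Hypothesis HB : case_B G K.
Let last_states := [set i : 'I_N | (K <= i)%N].

Let Bstruct := case_B_structure hlam hlr lam0 HB.
Let lB (i : 'I_N) : (i < K)%N -> l 0 i = 0.
Proof. by have [_ + _ _] := Bstruct; exact. Qed.

Let lrB (i : 'I_N) : (K <= i)%N -> 0 < l 0 i * r i 0.
Proof. by have [_ _ + _] := Bstruct; exact. Qed.
Let expB m (i j : 'I_N) : (K <= i)%N -> (j < K)%N -> (A ^+ m) i j = 0.
Proof. by have [_ _ _] := Bstruct; exact. Qed.

Let rB (i : 'I_N) : (K <= i)%N -> r i 0 != 0.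
Proof. by move=> /lrB; apply: contraTneq => ->; rewrite mulr0 ltxx. Qed.

Let PB m (i j : 'I_N) : (K <= i)%N -> (j < K)%N -> (P ^+ m) i j = 0.
Proof.
by move=> Ki jK; rewrite limit_exp ?rB// expB// mulr0 mul0r.
Qed.

Let P_gt0 (i j : 'I_N) : r i 0 != 0 -> (K <= j)%N -> exists m, 0 < (P ^+ m) i j.
Proof.
move=> ri /lrB lj.
have [m mP] := doob_eventually_gt0 A0 lam0 r0 Ar exp_cwM_cvg PE1 ri lj.
by exists m; exact: mP.
Qed.

Let last_closed i j : last_states i -> 0 < P i j -> last_states j.
Proof.
rewrite /last_states /= => Ki; case: (ltnP j K) => // jK.
by have := PB 1 Ki jK; rewrite expr1 => ->; rewrite ltxx.
Qed.

Lemma closed_exp (C : set 'I_N) m i j :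
  (forall i j, C i -> 0 < P i j -> C j) -> C i -> 0 < (P ^+ m) i j -> C j.
Proof.
move=> Ccl; elim: m j => [|m IH] j Ci.
  by rewrite expr0 mxE; case: eqP => [<-//|_]; rewrite ltxx.
rewrite exprSr -[X in _ < X]/((P ^+ m *m P) i j) mxE => h.
have P0 p q : 0 <= P p q by have [/(_ q)] := Pst p; rewrite mxE.
have [k [Pik Pkj]] : exists k, 0 < (P ^+ m) i k /\ 0 < P k j.
  apply: contrapT => H; move: h; rewrite big1 ?ltxx// => k _.
  apply/eqP/negPn/negP; rewrite mulf_eq0 negb_or => /andP[h1 h2]; apply: H.
  by exists k; rewrite !lt0r h1 h2 P0 exp_mx_ge0.
exact: Ccl (IH _ Ci Pik) Pkj.
Qed.

Lemma last_states_ergodic : ergodic_on last_states P.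
Proof. by apply: limit_ergodic => i; exact: lrB. Qed.

(** A closed class contains every last state, since these are charged at large times
    from any reachable state; it cannot contain any other state, as the last states
    do not lead to the first ones. *)
Lemma last_states_unique_component (C : set 'I_N) :
  (C `<=` reachable mu X /\ ergodic_component P C) <-> C = last_states.
Proof.
split=> [[Creach [[i Ci] Ccl Ccom]]|->]; last first.
  split.
    by move=> i /lrB lr0; apply: limit_reachable_stationary; rewrite gt_eqF.
  split; [|exact: last_closed|by have [] := last_states_ergodic].
  by have [[i0 Ki0] _ _ _] := Bstruct; exists i0.
have CL j : last_states j -> C j.
  move=> Kj; have [m mP] := P_gt0 (limit_reachable_right (Creach _ Ci)) Kj.
  exact: closed_exp Ccl Ci mP.
apply/seteqP; split=> // j Cj; rewrite /last_states /=; case: leqP => // jK.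
have [[i0 Ki0] _ _ _] := Bstruct.
have [m] := Ccom i0 j (CL _ Ki0) Cj.
by rewrite PB// ltxx.
Qed.

Lemma first_states_transient (i : 'I_N) : (i < K)%N -> r i 0 != 0 -> transient P i.
Proof.
move=> iK ri; have [[i0 Ki0] _ _ _] := Bstruct.
have [m mP] := P_gt0 ri Ki0.
apply: (transient_to_closed Pst last_closed _ Ki0 mP).
by rewrite /last_states /= leqNgt iK.
Qed.

(** As [l i = 0], the probability of being in [i] at time [m] is a combination of the
    errors in the convergence of [M ^+ m / lam ^+ m], which decay geometrically; the
    Borel-Cantelli lemma applies. *)
Lemma first_states_visited_finitely (i : 'I_N) : (i < K)%N ->
  mu (visited_infinitely_often X i) = 0%E.
Proof.
move=> iK; apply: lim_sup_set_cvg0.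
  move=> m; apply: (@measurable_states m (fun s => s m = i)) => s t st <-.
  by rewrite st.
pose u k := lam ^- k * (wI *m A ^+ k) 0 i * r i 0 / (wI *m r) 0 0.
have uE k : u k = \sum_j (wI 0 j * r i 0 / (wI *m r) 0 0) *
    (lam ^- k * (A ^+ k) j i - r j 0 * l 0 i).
  rewrite /u [(wI *m A ^+ k) 0 i]mxE mulr_sumr !mulr_suml.
  by apply: eq_bigr => j _; rewrite lB//; ring.
rewrite (eq_eseriesr (g := fun k => (u k)%:E)); last first.
  by move=> k _; exact: limit_prob_state.
apply: (@geometric_decay_summable _ u).
  rewrite (funext uE); apply: geometric_decay_sum => j.
  by apply: geometric_decay_scale; exact: dominant_powers_decay.
move=> k; rewrite /u divr_ge0 ?(ltW wr0)// mulr_ge0//.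
rewrite mulr_ge0 ?invr_ge0 ?exprn_ge0 ?(ltW lam0)//.
by rewrite mxE sumr_ge0// => j _; rewrite mulr_ge0 ?cwI_ge0// exp_mx_ge0.
Qed.

End CaseB.
End TransitionMatrix.
End LimitChain.

(** * Independence of the choice of the eigenvectors *)
Lemma eigenpair_right_scale (R : realType) (N : nat) (G : cwg R N) (lam : R)
    (l l' : 'rV[R]_N) (r r' : 'cV[R]_N) :
  dominant_eigenvalue (cwM G) lam%:C%C ->
  eigenpair (cwM G) lam l r -> eigenpair (cwM G) lam l' r' ->
  exists2 c, c != 0 & r' = c *: r.
Proof.
move=> hlam hlr hlr'; have [_ _ Ar' _] := hlr'.
exists ((l *m r') 0 0); last exact: (dominant_right_unique hlam hlr Ar').
apply/eqP => c0; have [k _] := eigenpair_neq0 hlr'.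
by rewrite (dominant_right_unique hlam hlr Ar') c0 scale0r mxE ltxx.
Qed.

Lemma initial_dist_scale (R : realType) (N : nat) (G : cwg R N) c (r : 'cV[R]_N) :
  c != 0 -> initial_dist G (c *: r) = initial_dist G r.
Proof.
move=> c0; apply/rowP => i; rewrite mxE [RHS]mxE -scalemxAr.
rewrite [(c *: r) i 0]mxE [(c *: (_ *m _)) 0 0]mxE.
by rewrite mulrCA -mulf_div divff// mul1r.
Qed.

Lemma transition_mx_scale (R : realType) (N : nat) (G : cwg R N) (lam c : R)
    (r : 'cV[R]_N) (P : 'M[R]_N) :
  c != 0 -> transition_mx G lam (c *: r) P <-> transition_mx G lam r P.
Proof.
move=> c0; split=> H i; have [H1 H2] := H i; split=> ri.
- by move=> j; rewrite H1 ?mxE ?mulf_neq0// -mulf_div divff// mul1r.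
- by apply: H2; rewrite mxE ri mulr0.
- move=> j; rewrite H1; first by rewrite !mxE -mulf_div divff// mul1r.
  by apply: contra_neq ri => ri; rewrite mxE ri mulr0.
- by apply: H2; move: ri; rewrite mxE => /eqP; rewrite mulf_eq0 (negPf c0) => /eqP.
Qed.

(** * Convergence to a Markov chain *)
Theorem theorem3p6 (R : realType) (N : nat) (G : cwg R N) (lam : R)
    (l : 'rV[R]_N) (r : 'cV[R]_N)
    (hlam : dominant_eigenvalue (cwM G) lam%:C%C)
    (hlr : eigenpair (cwM G) lam l r) :
  exists mu : probability (borelType (Omega G)) R,
  [/\ weakly_cvg (fun k => wdist G k) mu,
      mu (infinite_paths G) = 1%E,
      (forall i, reachable mu (nth_state G) i -> r i 0 != 0),
      (forall (l' : 'rV[R]_N) (r' : 'cV[R]_N), eigenpair (cwM G) lam l' r' ->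
         initial_dist G r' = initial_dist G r /\
         forall P, transition_mx G lam r' P <-> transition_mx G lam r P)
    & forall P : 'M[R]_N, transition_mx G lam r P ->
      [/\ markov_chain mu (nth_state G) (initial_dist G r) P,
          (forall p : 'rV[R]_N,
             stationary_on (reachable mu (nth_state G)) P p <->
             p = \row_i (l 0 i * r i 0)),
          (case_A G -> ergodic_on setT P)
        & forall K : nat, case_B G K ->
          let last_states := [set i : 'I_N | (K <= i)%N] in
          [/\ (forall C : set 'I_N,
                 (C `<=` reachable mu (nth_state G) /\ ergodic_component P C)
                 <-> C = last_states),
              ergodic_on last_states P,
              (forall i : 'I_N, (i < K)%N -> r i 0 != 0 -> transient P i)
            & forall i : 'I_N, (i < K)%N ->
                mu (visited_infinitely_often (nth_state G) i) = 0%E]]].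
Proof.
have lam0 : 0 < lam.
  by apply: dominant_gt0 hlam hlr (cw_gt1 G); exact: cwM_ge0.
have [mu [muC muI]] := path_measure_exists (limit_prob_ge0 hlam hlr) erefl
  (limit_prob_sum hlam hlr) (@limit_prob_path _ _ G lam r).
exists mu; split.
- exact: (limit_weakly_cvg hlam hlr muC muI).
- by apply: muI => //; exact: measurable_infinite.
- exact: (limit_reachable_right hlam hlr muC muI).
- move=> l' r' hlr'; have [c c0 ->] := eigenpair_right_scale hlam hlr hlr'.
  by split=> [|P]; [exact: initial_dist_scale|exact: transition_mx_scale].
move=> P PE; split.
- exact: (limit_markov_chain hlam hlr muC muI PE).
- exact: (limit_stationary hlam hlr muC muI PE).
- exact: (limit_case_A hlam hlr PE).
move=> K HB last_states; split.
- exact: (last_states_unique_component hlam hlr muC muI PE HB).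
- exact: (last_states_ergodic hlam hlr PE HB).
- exact: (first_states_transient hlam hlr PE HB).
- exact: (first_states_visited_finitely hlam hlr muC muI HB).
Qed.
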